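(* Let $(E,\rho)$ be a weighted space and $(P(t))_{t\ge0}$ a generalized Feller semigroup on $\mathscr{B}^\rho(E)$ with $P(t)1=1$ for all $t$, with generator $A$, and let $M\ge1$, $\omega\in\mathbb{R}$ satisfy $\|P(t)\|\le Me^{\omega t}$ for all $t\ge0$. Let $\nu\in\mathcal{M}^\rho(E)$ be a probability measure and let $(\lambda_t)$, $\mathbb{P}_\nu$, $(\mathcal{F}_t)$ be the canonical process, probability measure and complete right-continuous filtration on $(E^{\mathbb{R}_+},\mathcal{B}(E)^{\mathbb{R}_+})$ for which $\lambda$ is adapted, $\mathbb{P}_\nu\circ\lambda_0^{-1}=\nu$ and $\mathbb{E}_\nu[f(\lambda_t)\mid\mathcal{F}_s]=P(t-s)f(\lambda_s)$ a.s. for all $t\ge s\ge0$, $f\in\mathscr{B}^\rho(E)$. Then: (i) For every countable family $(f_n)_{n\in\mathbb{N}}\subset\mathscr{B}^\rho(E)$ there are processes $(\bar Z^{\beta,n}_t)_{t\ge0}$ with càdlàg paths, indexed by $n\in\mathbb{N}$ and integers $\beta>\omega$, such that for each $t\ge0$ there is a $\mathbb{P}_\nu$-null set $\mathcal{N}_t\in\mathcal{F}_0$ with $\beta R(\beta,A)f_n(\lambda_t)=\bar Z^{\beta,n}_t$ outside $\mathcal{N}_t$ for all such $n,\beta$. (ii) Suppose in addition $\rho$ is $\mathcal{B}_0(E)$-measurable and $M$ can be chosen equal to $1$. Then $(e^{-\omega t}\rho(\lambda_t))_{t\ge0}$ is an $(\mathcal{F}_t)$-supermartingale. If moreover $t\mapsto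 P(t)\rho(x)$ is continuous for $\nu$-a.e. $x\in E$, this supermartingale has a càdlàg version, and for every countable family $(f_n)\subset\mathscr{B}^\rho(E)$ there are càdlàg processes $(\overline{f_n(\lambda_t)})_{t\ge0}$ such that for each $t\ge0$ there is a null set $\mathcal{N}'_t\in\mathcal{F}_0$ with $f_n(\lambda_t)=\overline{f_n(\lambda_t)}$ outside $\mathcal{N}'_t$ for all $n$. (iii) If in addition to the assumptions of (ii) there exists a countable family $(f_n)\subset\mathscr{B}^\rho(E)$ of sequentially continuous functions that separates the points of $E$, then $(\lambda_t)$ has a version with càdlàg paths.
   Context: A weighted space is a pair $(E,\rho)$ where $E$ is a completely regular Hausdorff topological space and $\rho:E\to(0,\infty)$ is an admissible weight function, meaning that for every $R\ge 0$ the sublevel set $K_R:=\{x\in E:\rho(x)\le R\}$ is compact. For $f:E\to\mathbb{R}$ put $\|f\|_\rho:=\sup_{x\in E}|f(x)|/\rho(x)$; $\mathscr{B}^\rho(E)$ denotes the closure of $C_b(E)$ with respect to $\|\cdot\|_\rho$ inside $\{f:E\to\mathbb{R}:\|f\|_\rho<\infty\}$. A generalized Feller semigroup on $\mathscr{B}^\rho(E)$ is a family $(P(t))_{t\ge0}$ of bounded linear operators on $\mathscr{B}^\rho(E)$ such that (P1) $P(0)=\mathrm{Id}$; (P2) $P(t+s)=P(s)P(t)$ for all $s,t\ge0$; (P3) $\lim_{t\downarrow0}P(t)f(x)=f(x)$ for all $f\in\mathscr{B}^\rho(E)$, $x\in E$; (P4) there exist $\varepsilon>0$, $C<\infty$ with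 $\|P(t)\|_{L(\mathscr{B}^\rho(E))}\le C$ for all $t\in[0,\varepsilon]$; (P5) each $P(t)$ is a positive operator. Such a semigroup is strongly continuous on $\mathscr{B}^\rho(E)$; $A$ denotes its infinitesimal generator and $R(\beta,A)=(\beta-A)^{-1}=\int_0^\infty e^{-\beta s}P(s)\,ds$ its resolvent for $\beta>\omega$. For each $t,x$ there is a unique positive finite Radon measure $p(t)(x,\cdot)$ on $\mathcal{B}(E)$ with $P(t)f(x)=\int f\,dp(t)(x,\cdot)$ for $f\in\mathscr{B}^\rho(E)$, and $P(t)\rho(x):=\int_E\rho(y)\,p(t)(x,dy)=\sup\{|P(t)f(x)|: f\in C_b(E),|f|\le\rho\}$. $\mathcal{M}^\rho(E)$ is the set of signed Radon measures $\mu$ on $\mathcal{B}(E)$ with $\int\rho\,d|\mu|<\infty$; $\mathcal{B}_0(E)$ is the Baire σ-algebra (smallest σ-algebra making all bounded continuous functions measurable). A function $f$ is sequentially continuous if $x_m\to x$ implies $f(x_m)\to f(x)$. *)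

(* Defs.v *)
From HB Require Import structures.
From mathcomp Require Import all_boot all_order all_algebra.
From mathcomp Require Import all_classical all_reals all_analysis.
Set Implicit Arguments. Unset Strict Implicit. Unset Printing Implicit Defensive.
Import Order.TTheory GRing.Theory Num.Theory.
Import numFieldNormedType.Exports.
Local Open Scope classical_set_scope.
Local Open Scope ring_scope.

(* ---------- weighted spaces ---------- *)

(* (E, rho) is a weighted space: E completely regular Hausdorff, rho > 0,
   and every sublevel set K_r = {rho <= r}, r >= 0, is compact. *)
Definition weighted_space (R : realType) (E : ptopologicalType) (rho : E -> R) : Prop :=
  completely_regular_space E /\ hausdorff_space E /\
  (forall x, 0 < rho x) /\
  (forall r : R, 0 <= r -> compact [set x | rho x <= r]).

(* ||f||_rho = sup_x |f x| / rho x  (in the extended reals) *)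
Definition rho_norm (R : realType) (E : Type) (rho : E -> R) (f : E -> R) : \bar R :=
  ereal_sup [set (`|f x| / rho x)%:E | x in [set: E]].

(* bounded continuous functions C_b(E) *)
Definition Cb (R : realType) (E : topologicalType) (f : E -> R) : Prop :=
  continuous f /\ exists C : R, forall x, `|f x| <= C.

(* B^rho(E): closure of C_b(E) in {f : ||f||_rho < oo} for ||.||_rho *)
Definition Brho (R : realType) (E : topologicalType) (rho : E -> R) (f : E -> R) : Prop :=
  (rho_norm rho f < +oo)%E /\
  forall e : R, 0 < e -> exists g, Cb g /\ (rho_norm rho (fun x => (f x - g x)%R) <= e%:E)%E.

(* ---------- generalized Feller semigroups ---------- *)
(* A family (P t)_{t >= 0} of operators, P t acting on functions E -> R;
   only its action on B^rho(E) is relevant. *)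
Definition gen_feller_semigroup (R : realType) (E : topologicalType) (rho : E -> R)
    (P : R -> (E -> R) -> (E -> R)) : Prop :=
  (* each P t is a bounded linear operator on B^rho(E) *)
  (forall t, 0 <= t -> forall f, Brho rho f -> Brho rho (P t f)) /\
  (forall t, 0 <= t -> forall (a b : R) f g, Brho rho f -> Brho rho g ->
     P t (fun x => a * f x + b * g x) = (fun x => a * P t f x + b * P t g x)) /\
  (forall t, 0 <= t -> exists C : R, forall f, Brho rho f ->
     (rho_norm rho (P t f) <= C%:E * rho_norm rho f)%E) /\
  (* (P1) *)
  (forall f, Brho rho f -> P 0 f = f) /\
  (* (P2) *)
  (forall s t, 0 <= s -> 0 <= t -> forall f, Brho rho f ->
     P (t + s) f = P s (P t f)) /\
  (* (P3) *)
  (forall f, Brho rho f -> forall x, P t f x @[t --> 0^'+] --> f x) /\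
  (* (P4) *)
  (exists (eps C : R), 0 < eps /\ forall t, 0 <= t <= eps -> forall f, Brho rho f ->
     (rho_norm rho (P t f) <= C%:E * rho_norm rho f)%E) /\
  (* (P5) positivity *)
  (forall t, 0 <= t -> forall f, Brho rho f -> (forall x, 0 <= f x) ->
     forall x, 0 <= P t f x).

(* ||P(t)||_{L(B^rho)} <= M e^{omega t} for all t >= 0 *)
Definition growth_bound (R : realType) (E : topologicalType) (rho : E -> R)
    (P : R -> (E -> R) -> (E -> R)) (M omega : R) : Prop :=
  forall t, 0 <= t -> forall f, Brho rho f ->
    (rho_norm rho (P t f) <= (M * expR (omega * t))%:E * rho_norm rho f)%E.

(* resolvent R(beta, A) f (x) = int_0^oo e^{-beta s} P(s) f (x) ds *)
Definition resolvent (R : realType) (E : Type) (P : R -> (E -> R) -> (E -> R))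
    (beta : R) (f : E -> R) (x : E) : R :=
  fine (\int[lebesgue_measure]_(s in [set s : R | (0 <= s)%R])
          ((expR (- (beta * s)) * P s f x)%R)%:E).

(* P(t) rho (x) = sup { |P(t) f (x)| : f in C_b(E), |f| <= rho } *)
Definition P_rho (R : realType) (E : topologicalType) (rho : E -> R)
    (P : R -> (E -> R) -> (E -> R)) (t : R) (x : E) : \bar R :=
  ereal_sup [set (`|P t f x|)%:E | f in [set f | Cb f /\ forall y, `|f y| <= rho y]].

(* ---------- measure-theoretic notions on E ---------- *)

(* Borel sigma-algebra of E *)
Definition borelE (E : ptopologicalType) := g_sigma_algebraType (@open E).

(* Baire sigma-algebra B_0(E) *)
Definition baire_sets (R : realType) (E : topologicalType) : set (set E) :=
  <<s [set A | exists f : E -> R, exists B : set R,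
          Cb f /\ measurable B /\ A = f @^-1` B] >>.

(* nu is a Radon probability measure in M^rho(E) *)
Definition radon_prob_in_Mrho (R : realType) (E : ptopologicalType) (rho : E -> R)
    (nu : probability (borelE E) R) : Prop :=
  (forall A : set (borelE E), measurable A ->
     nu A = ereal_sup [set nu K | K in [set K : set (borelE E) | compact (K : set E) /\ K `<=` A]]) /\
  (\int[nu]_x (rho x)%:E < +oo)%E.

Definition seq_continuous (R : realType) (E : topologicalType) (f : E -> R) : Prop :=
  forall (u : nat -> E) (x : E), u n @[n --> \oo] --> x -> f (u n) @[n --> \oo] --> f x.

(* ---------- the canonical space E^{R_+} ---------- *)

Definition Rplus (R : realType) := {t : R | 0 <= t}.
Definition Rplus0 (R : realType) : Rplus R := exist _ 0 (lexx (0 : R)).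

(* generators of the product sigma-algebra B(E)^{R_+} *)
Definition cyl_sets (R : realType) (E : ptopologicalType) : set (set (Rplus R -> E)) :=
  [set C | exists (i : Rplus R) (A : set E), <<s @open E >> A /\ C = (fun w => w i) @^-1` A].

Definition Omega (R : realType) (E : ptopologicalType) := g_sigma_algebraType (@cyl_sets R E).

(* canonical process lambda_t(w) = w(t) (for t >= 0) *)
Definition lam (R : realType) (E : ptopologicalType) (t : R) (w : Rplus R -> E) : E :=
  w (insubd (Rplus0 R) t).

(* completion of (Omega, B(E)^{R_+}, P_nu) *)
Definition OmegaBar (R : realType) (E : ptopologicalType) (Pnu : probability (@Omega R E) R) :=
  caratheodory_type (Pnu^*)%mu.

Definition Pbar (R : realType) (E : ptopologicalType) (Pnu : probability (@Omega R E) R) :=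
  @completed_measure_extension _ (@Omega R E) R Pnu.

(* ---------- stochastic notions on the completed space ---------- *)

(* P_nu-null sets (w.r.t. the completed measure) *)
Definition Pnull (R : realType) (E : ptopologicalType) (Pnu : probability (@Omega R E) R)
    (N : set (OmegaBar Pnu)) : Prop :=
  measurable N /\ @Pbar _ _ Pnu N = 0%E.

(* F is a complete right-continuous filtration of sub-sigma-algebras of
   the completed sigma-algebra *)
Definition complete_rc_filtration (R : realType) (E : ptopologicalType)
    (Pnu : probability (@Omega R E) R) (F : R -> set (set (OmegaBar Pnu))) : Prop :=
  (forall t, 0 <= t -> sigma_algebra [set: OmegaBar Pnu] (F t)) /\
  (forall t, 0 <= t -> F t `<=` measurable) /\
  (forall s t, 0 <= s <= t -> F s `<=` F t) /\
  (forall t, 0 <= t -> F t = [set A | forall u, t < u -> F u A]) /\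
  (forall N, Pnull N -> F 0 N).

(* X is G-measurable (G a sigma-algebra on Omega, X real valued) *)
Definition Gmeas (T : Type) (R : realType) (G : set (set T)) (X : T -> R) : Prop :=
  forall B : set R, measurable B -> G (X @^-1` B).

(* Y is a version of the conditional expectation E[X | G] under Pbar *)
Definition cond_exp_version (R : realType) (E : ptopologicalType)
    (Pnu : probability (@Omega R E) R) (G : set (set (OmegaBar Pnu)))
    (X Y : OmegaBar Pnu -> R) : Prop :=
  (@Pbar _ _ Pnu).-integrable [set: OmegaBar Pnu] (EFin \o X) /\
  Gmeas G Y /\
  (@Pbar _ _ Pnu).-integrable [set: OmegaBar Pnu] (EFin \o Y) /\
  forall B, G B ->
    (\int[@Pbar _ _ Pnu]_(w in B) (X w)%:E = \int[@Pbar _ _ Pnu]_(w in B) (Y w)%:E)%E.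

(* (X_t)_{t >= 0} is an (F_t)-supermartingale under Pbar *)
Definition supermartingale (R : realType) (E : ptopologicalType)
    (Pnu : probability (@Omega R E) R) (F : R -> set (set (OmegaBar Pnu)))
    (X : R -> OmegaBar Pnu -> R) : Prop :=
  (forall t, 0 <= t -> Gmeas (F t) (X t) /\
     (@Pbar _ _ Pnu).-integrable [set: OmegaBar Pnu] (EFin \o X t)) /\
  (forall s t, 0 <= s <= t -> exists Y, cond_exp_version (F s) (X t) Y /\
     exists N, Pnull N /\ forall w, ~ N w -> Y w <= X s w).

(* a path g : [0, oo) -> V is cadlag *)
Definition cadlag (R : realType) (V : topologicalType) (g : R -> V) : Prop :=
  (forall t : R, 0 <= t -> g u @[u --> t^'+] --> g t) /\
  (forall t : R, 0 < t -> exists l : V, g u @[u --> t^'-] --> l).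

(* Main.v *)
Require Import Defs.
From HB Require Import structures.
From mathcomp Require Import all_boot all_order all_algebra.
From mathcomp Require Import all_classical all_reals all_analysis.
From mathcomp Require Import measurable_realfun.
From mathcomp Require Import ring lra.
Set Implicit Arguments. Unset Strict Implicit. Unset Printing Implicit Defensive.
Import Order.TTheory GRing.Theory Num.Theory.
Import numFieldNormedType.Exports.
Local Open Scope classical_set_scope.
Local Open Scope ring_scope.

(** For f >= 0 in B^rho, Tonelli and the Markov property make
    e^(-beta t) R(beta, A) f (lambda_t) a nonnegative supermartingale, so by
    Doob's upcrossing argument almost every path has one-sided limits along
    the dyadic numbers; the right limits form the cadlag version.  That the
    right limit of g(lambda) at t is g(lambda_t), for g in B^rho, follows by
    applying the Markov property to min((g - a)^+, 1) on the event
    {g(lambda_t) <= a}.  The resolvent preserves B^rho because P(u) f is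
    determined by the countable family P(q) f, q dyadic, so that its continuity
    on the compact sets {rho <= r} reduces to dominated convergence along
    sequences.

    If rho is Baire measurable, the compact sets {rho <= r} are zero sets, so
    rho is the supremum of a sequence of bounded continuous functions, and
    e^(-omega t) rho(lambda_t) is a supermartingale.  Hence almost every path
    stays, locally in time and along the dyadic numbers, in a compact set
    {rho <= r}.  Two cluster points of such a path at a given time have the
    same resolvents R(beta, A) f, hence the same value of f; so f(lambda) has
    one-sided limits, and if countably many such f separate points, so does
    lambda itself. *)

(** * Limits along the dyadic numbers *)

(** The product sigma-algebra sees only countably many times at once; this forces the restriction to
    dyadic times. The right limit, with a fixed default value on exceptional paths, then gives
    versions all of whose paths are càdlàg. A second obstacle is that functions of B^rho are in
    general continuous only on each set {rho <= r}, while E need not be metrizable. Convergence is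
    therefore proved with cluster points of filters: a cluster point in a compact set is pinned down
    by a family of functions continuous on that set. One trading strategy serves twice: between a
    and a + j + 1 it bounds the paths, between two dyadic levels it excludes oscillation. The
    constant 1 in the growth bound makes e^(-omega t) rho(lambda_t) a supermartingale; a constant M
    > 1 would survive in the conditional estimate. Since rho need not lie in B^rho, its right limit
    is identified differently: bounded continuous functions below rho give one inequality, Fatou's
    lemma gives the other one in mean. *)

Definition dyadic (R : realType) : set R :=
  [set q | exists n i : nat, q = i%:R / 2 ^+ n].

Lemma pow2_gt0 (R : realType) n : (0 : R) < 2 ^+ n.
Proof. by rewrite exprn_gt0. Qed.

Lemma pow2_ge0 (R : realType) n : (0 : R) <= 2 ^+ n.
Proof. exact/ltW/pow2_gt0. Qed.

Lemma dyadic_ge0 (R : realType) (q : R) : dyadic q -> 0 <= q.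
Proof. by move=> [n [i ->]]; rewrite divr_ge0// ltW// pow2_gt0. Qed.

(* For t < 0 the truncation is 0 and the value is 2^-n. *)
Definition dyadic_above (R : realType) (t : R) (n : nat) : R :=
  (Num.trunc (t * 2 ^+ n)).+1%:R / 2 ^+ n.

Lemma dyadic_dyadic_above (R : realType) (t : R) n : dyadic (dyadic_above t n).
Proof. by exists n, (Num.trunc (t * 2 ^+ n)).+1. Qed.

(** The successor in the numerator makes the inequality strict even at dyadic [t]; the sequence thus
    stays in the punctured right neighbourhoods where right limits are taken. *)
Lemma dyadic_above_gt (R : realType) (t : R) n : t < dyadic_above t n.
Proof.
rewrite /dyadic_above ltr_pdivlMr ?pow2_gt0//.
have [t0|t0] := leP 0 t; last first.
  by apply: (@lt_le_trans _ _ 0); rewrite // nmulr_rlt0// pow2_gt0.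
by have /andP[] := truncn_itv (mulr_ge0 t0 (ltW (pow2_gt0 R n))).
Qed.

Lemma dyadic_above_le (R : realType) (t : R) n :
  dyadic_above t n <= Num.max t 0 + 2 ^- n.
Proof.
rewrite /dyadic_above ler_pdivrMr ?pow2_gt0// mulrDl mulVf; last first.
  by rewrite gt_eqF// pow2_gt0.
rewrite -natr1 lerD2r; have [t0|t0] := leP t 0.
  rewrite mul0r; have -> // : Num.trunc (t * 2 ^+ n) = 0%N.
  apply/truncn0Pn; rewrite -ltNge (@le_lt_trans _ _ 0)//.
  by rewrite pmulr_lle0// pow2_gt0.
by have /andP[] := truncn_itv (mulr_ge0 (ltW t0) (ltW (pow2_gt0 R n))).
Qed.

Lemma cvg_pow2V (R : realType) : (2 ^- n : R) @[n --> \oo] --> (0 : R).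
Proof.
have := @cvg_geometric R 1 2^-1 _.
rewrite /geometric /=; under eq_fun do rewrite mul1r exprVn.
by apply; rewrite ger0_norm// invf_lt1// ltr1n.
Qed.

Lemma cvg_dyadic_above (R : realType) (t : R) : 0 <= t ->
  dyadic_above t n @[n --> \oo] --> t.
Proof.
move=> t0; apply: (@squeeze_cvgr _ _ _ _ (fun=> t) (fun n => t + 2 ^- n)).
- near=> n; rewrite ltW ?dyadic_above_gt//=.
  by rewrite (le_trans (dyadic_above_le _ _))// max_l.
- exact: cvg_cst.
- rewrite -[X in _ --> X]addr0; apply: cvgD; first exact: cvg_cst.
  exact: cvg_pow2V.
Unshelve. all: by end_near. Qed.

Lemma dyadic_dense (R : realType) (a b : R) : 0 <= a -> a < b ->
  exists q, [/\ dyadic q, a < q & q < b].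
Proof.
move=> a0 ab; have : \forall n \near \oo, dyadic_above a n < b.
  by apply: (cvgr_lt a) => //; exact: cvg_dyadic_above.
by move=> [n _ /(_ n (leqnn n)) h]; exists (dyadic_above a n); split => //;
  [exact: dyadic_dyadic_above|exact: dyadic_above_gt].
Qed.

Definition dright (R : realType) (t : R) : set_system R := within (@dyadic R) t^'+.
Definition dleft (R : realType) (t : R) : set_system R := within (@dyadic R) t^'-.

Lemma drightP (R : realType) (t : R) (A : set R) : dright t A <->
  exists2 e, 0 < e & forall q, dyadic q -> t < q < t + e -> A q.
Proof.
split.
- move=> [e /= e0 h]; exists e => // q dq /andP[tq qt].
  apply: (h q) => //=; rewrite ltr0_norm ?subr_lt0// opprB ltrBlDl//.
- move=> [e e0 h]; exists e => //= q qe tq dq; apply: h => //.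
  by rewrite tq/= -ltrBlDl; move: qe; rewrite /= ltr0_norm ?subr_lt0// opprB.
Qed.

Lemma dleftP (R : realType) (t : R) (A : set R) : dleft t A <->
  exists2 e, 0 < e & forall q, dyadic q -> t - e < q < t -> A q.
Proof.
split.
- move=> [e /= e0 h]; exists e => // q dq /andP[tq qt].
  apply: (h q) => //=; rewrite gtr0_norm ?subr_gt0// ltrBlDl -ltrBlDr//.
- move=> [e e0 h]; exists e => //= q qe tq dq; apply: h => //.
  by rewrite tq andbT ltrBlDl -ltrBlDr; move: qe; rewrite /= gtr0_norm ?subr_gt0.
Qed.

Global Instance dright_filter (R : realType) (t : R) : Filter (dright t).
Proof. exact: within_filter. Qed.
Global Instance dleft_filter (R : realType) (t : R) : Filter (dleft t).
Proof. exact: within_filter. Qed.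

Lemma dright_proper (R : realType) (t : R) : 0 <= t -> ProperFilter (dright t).
Proof.
move=> t0; apply: Build_ProperFilter_ex => A /drightP[e e0 h].
have [|q [dq tq qt]] := @dyadic_dense R t (t + e) t0; first by rewrite ltrDl.
by exists q; apply: h => //; rewrite tq.
Qed.

Lemma dleft_proper (R : realType) (t : R) : 0 < t -> ProperFilter (dleft t).
Proof.
move=> t0; apply: Build_ProperFilter_ex => A /dleftP[e e0 h].
have [||q [dq tq qt]] := @dyadic_dense R (Num.max 0 (t - e)) t.
- by rewrite le_max lexx.
- by rewrite gt_max t0 ltrBlDr ltrDl.
by exists q; apply: h => //; rewrite qt andbT; move: tq; rewrite gt_max => /andP[].
Qed.

Lemma cvg_dyadic_above_dright (R : realType) (t : R) : 0 <= t ->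
  dyadic_above t n @[n --> \oo] --> dright t.
Proof.
move=> t0 A /drightP[e e0 h].
have : \forall n \near \oo, dyadic_above t n < t + e.
  by apply: (cvgr_lt t); [exact: cvg_dyadic_above|rewrite ltrDl].
apply: filterS => n hn; apply: h; first exact: dyadic_dyadic_above.
by rewrite dyadic_above_gt.
Qed.

(** Regulated functions in the usual sense, but seen only through their dyadic values; neither the
    value at [t] nor any non-dyadic value enters. *)
Definition regulated (R : realType) (V : topologicalType) (phi : R -> V) : Prop :=
  (forall t : R, 0 <= t -> exists l : V, phi @ dright t --> l) /\
  (forall t : R, 0 < t -> exists l : V, phi @ dleft t --> l).

(** A closed set that contains [phi q] for all dyadic [q] in an open interval also contains the
    right limits taken at points of that interval and at its left end. Regularity of [V] provides
    enough closed neighbourhoods. *)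
Lemma cadlag_dright_limit (R : realType) (V : topologicalType) (phi psi : R -> V) :
  @regular_space V -> regulated phi ->
  (forall t : R, 0 <= t -> phi @ dright t --> psi t) -> cadlag psi.
Proof.
move=> reg [_ hl] hpsi.
have key (s t : R) : 0 <= s -> s < t -> forall A, closed A ->
    (forall q, dyadic q -> s < q < t -> A (phi q)) ->
    forall u, s <= u < t -> A (psi u).
  move=> s0 st A cA hA u /andP[su ut].
  have u0 : 0 <= u := le_trans s0 su.
  have pu := dright_proper u0.
  apply: (@closed_cvg _ _ (dright u) pu phi) => //; last exact: hpsi.
  apply/drightP; exists (t - u); first by rewrite subr_gt0.
  move=> q dq /andP[uq]; rewrite subrKC => qt; apply: hA => //.
  by rewrite qt (le_lt_trans su).
split=> t t0.
- move=> A /reg[B /hpsi-/(_ t0) /drightP[e e0 hB] BA].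
  exists e => //= u ue tu; apply: BA.
  apply: (key t (t + e)) => //; first by rewrite ltrDl.
  + exact: closed_closure.
  + by move=> q dq hq; apply: subset_closure; exact: hB.
  + rewrite (ltW tu) -ltrBlDl; move: ue.
    by rewrite /= ltr0_norm ?subr_lt0// opprB.
- have [l hl0] := hl t t0; exists l => A /reg[B /hl0 /dleftP[e e0 hB] BA].
  (* The minimum with [t] keeps [u] positive, where [psi u] is known to be a right limit. *)
  exists (Num.min e t); first by rewrite /= lt_min e0.
  move=> u /= ue ut; apply: BA.
  move: ue; rewrite gtr0_norm ?subr_gt0// lt_min => /andP[ue ue'].
  apply: (key (Num.max 0 (t - e)) t) => //.
  + by rewrite le_max lexx.
  + by rewrite gt_max t0 ltrBlDr ltrDl.
  + exact: closed_closure.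
  + move=> q dq; rewrite gt_max => /andP[/andP[q0 qe] qt].
    by apply: subset_closure; apply: hB => //; rewrite qe.
  + rewrite ut andbT ge_max; apply/andP; split; first by lra.
    by lra.
Qed.

(** * Cluster points and maps continuous on a compact set *)

Definition within_cont (E V : topologicalType) (K : set E) (h : E -> V) : Prop :=
  forall x, K x -> h @ within K (nbhs x) --> h x.

Lemma cluster_within_cont (E V : topologicalType) (K : set E) (F : set_system E)
    (h : E -> V) (x : E) (A : set E) (B : set V) : Filter F ->
  within_cont K h -> K x -> cluster F x -> F K -> F A -> nbhs (h x) B ->
  exists z, [/\ A z, K z & B (h z)].
Proof.
move=> FF ch Kx clx FK FA /(ch _ Kx) Bx.
by have [z [[Az Kz] /= /(_ Kz) Bz]] := clx _ _ (filterI FA FK) Bx; exists z.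
Qed.

(** Argument by contradiction: along the indices where [f \o y] misses a neighbourhood of [f x],
    compactness yields a cluster point [z]. The limits of the [H j] force [H j z = H j x], hence
    [f z = f x], which is incompatible with missing the neighbourhood. The lemma is used with dyadic
    operators, with resolvents, and with a point-separating family and [f = id]. *)
Lemma cvg_cluster_separated (I : Type) (E V : topologicalType) (J : Type)
    (W : J -> topologicalType)
    (F : set_system I) (y : I -> E) (K : set E) (x : E) (H : forall j, E -> W j) (f : E -> V) :
  Filter F -> compact K -> F (y @^-1` K) -> K x ->
  (forall j, hausdorff_space (W j)) ->
  (forall j, within_cont K (H j)) -> within_cont K f ->
  (forall j, H j \o y @ F --> H j x) ->
  (forall z, K z -> (forall j, H j z = H j x) -> f z = f x) ->
  f \o y @ F --> f x.
Proof.
move=> FF cK FK Kx hW cH cf Hx sep B Bx.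
apply: contrapT => nFB.
(* The trace of [F] on the indices whose image misses [B]; it is proper exactly because [B] is not
   eventually reached. *)
have FF' : Filter (within (~` ((f \o y) @^-1` B)) F) by exact: within_filter.
have PF : ProperFilter (within (~` ((f \o y) @^-1` B)) F).
  apply: Build_ProperFilter => h0; apply: nFB.
  have {}h0 : F [set i | (~` ((f \o y) @^-1` B)) i -> False] := h0.
  suff : F ((f \o y) @^-1` B) by [].
  by apply: filterS h0 => i hi; apply: contrapT.
have [|z [Kz clz]] := cK (y @ within (~` ((f \o y) @^-1` B)) F) _.
  exact: cvg_within FK.
have fzx : f z = f x.
  apply: sep => // j; apply: (hW j) => A C Az Cx.
  have [||w [Cw _ Aw]] := @cluster_within_cont _ _ K _ (H j) z (H j @^-1` C) A _ (cH j) Kz clz _ _ Az.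
  - exact: cvg_within FK.
  - by apply: cvg_within; exact: (Hx j _ Cx).
  by exists (H j w).
have [|||w [/= [i nB <-] _ Bw]] := @cluster_within_cont _ _ K _ f z
    (y @` (~` ((f \o y) @^-1` B))) B _ cf Kz clz _ _ _.
- exact: cvg_within FK.
- by rewrite /= /within /=; apply: nearW => i hi; exists i.
- by rewrite fzx.
exact: nB.
Qed.

(** A single cluster point serves all [j] at once, because each [H j] already has a limit and
    continuity on [K] makes that limit its value at the cluster point. *)
Lemma cluster_limit (I : Type) (E : topologicalType) (J : Type)
    (W : J -> topologicalType)
    (F : set_system I) (y : I -> E) (K : set E) (H : forall j, E -> W j) :
  ProperFilter F -> compact K -> F (y @^-1` K) ->
  (forall j, hausdorff_space (W j)) ->
  (forall j, within_cont K (H j)) ->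
  (forall j, exists l : W j, H j \o y @ F --> l) ->
  exists2 x, K x & forall j, H j \o y @ F --> H j x.
Proof.
move=> PF cK FK hW cH Hl.
have [x [Kx clx]] := cK (y @ F) _ FK.
exists x => // j; have [l hl] := Hl j.
suff -> : H j x = l by [].
apply: (hW j) => A C Ax Cl.
have [|w [Cw _ Aw]] := @cluster_within_cont _ _ K _ (H j) x (H j @^-1` C) A _ (cH j) Kx clx FK _ Ax.
  exact: (hl _ Cl).
by exists (H j w).
Qed.

(** * Upcrossings of nonnegative supermartingales *)

(* The trader of Doob's upcrossing argument: buys below a, sells above b. *)
Fixpoint hold (R : realType) (a b : R) (x : nat -> R) (n : nat) : bool :=
  match n with
  | 0 => x 0 <= a
  | m.+1 => if hold a b x m then x m.+1 < b else x m.+1 <= a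
  end.

(** The discrete stochastic integral of the trader's position: the decision at [i] is exposed to the
    next increment. *)
Definition gain (R : realType) (a b : R) (x : nat -> R) (n : nat) : R :=
  \sum_(i < n) (hold a b x i)%:R * (x i.+1 - x i).

(** Counts sales, that is, completed upcrossings. *)
Definition upcross (R : realType) (a b : R) (x : nat -> R) (n : nat) : nat :=
  (\sum_(i < n) (hold a b x i && (b <= x i.+1)%R))%N.

(** Invariant of the strategy: each sale has earned at least [b - a], and an open position was
    bought for at most [a], so it is worth at least [x n - a] more than it cost. The open position
    is kept in the statement to make the induction work. *)
Lemma gain_ge_hold (R : realType) (a b : R) (x : nat -> R) n : a < b ->
  (b - a) * (upcross a b x n)%:R + (if hold a b x n then x n - a else 0)
  <= gain a b x n.
Proof.
move=> ab; rewrite /gain /upcross; elim: n => [|n IH].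
  by rewrite !big_ord0 mulr0 add0r /=; case: ifP => //; rewrite subr_le0.
rewrite !big_ord_recr /=.
set U := (\sum_(i < n) _)%N in IH *.
set Y := \sum_(i < n) _ in IH *.
case: (hold a b x n) IH => /=; last first.
  rewrite addn0 mul0r addr0 addr0 => IH; case: ifP => h; last by rewrite addr0.
  by rewrite (le_trans _ IH)// gerDl subr_le0.
rewrite mul1r => IH; case: (ltP (x n.+1) b) => /= h.
  by rewrite addn0; lra.
by rewrite natrD mulrDr mulr1 addr0; lra.
Qed.

(** For nonnegative prices an open position can lose at most [a]. *)
Lemma gain_ge (R : realType) (a b : R) (x : nat -> R) n : 0 <= a -> a < b ->
  (forall i, 0 <= x i) -> (b - a) * (upcross a b x n)%:R <= gain a b x n + a.
Proof.
move=> a0 ab x0; have := @gain_ge_hold R a b x n ab.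
by have := x0 n; case: ifP => _; lra.
Qed.

Lemma upcross_mono (R : realType) (a b : R) (x : nat -> R) i j : (i <= j)%N ->
  (upcross a b x i <= upcross a b x j)%N.
Proof.
elim: j => [|j IH]; first by rewrite leqn0 => /eqP ->.
rewrite leq_eqVlt => /orP[/eqP -> //|]; rewrite ltnS => /IH /leq_trans; apply.
by rewrite /upcross big_ord_recr/= leq_addr.
Qed.

Lemma upcross_sell (R : realType) (a b : R) (x : nat -> R) i j : (i <= j)%N ->
  hold a b x i -> ~~ hold a b x j -> (upcross a b x i < upcross a b x j)%N.
Proof.
move=> + hi; elim: j => [|j IH]; first by rewrite leqn0 => /eqP <-; rewrite hi.
rewrite leq_eqVlt => /orP[/eqP <-|]; first by rewrite hi.
rewrite ltnS => ij; rewrite {2}/upcross big_ord_recr /= -/(upcross a b x j).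
case: ifP => hj; last by move=> _; rewrite addn0 IH// hj.
by rewrite -leNgt => -> /=; rewrite addn1 ltnS upcross_mono.
Qed.

Lemma hold_low (R : realType) (a b : R) (x : nat -> R) i : a < b ->
  x i <= a -> hold a b x i.
Proof.
by move=> ab; case: i => //= i xa; case: ifP => // _; rewrite (le_lt_trans xa).
Qed.

Lemma hold_high (R : realType) (a b : R) (x : nat -> R) i : a < b ->
  b <= x i -> ~~ hold a b x i.
Proof.
move=> ab; case: i => [|i] xb /=; first by rewrite -ltNge (lt_le_trans ab).
by case: ifP => _; rewrite -?leNgt// -?ltNge// (lt_le_trans ab).
Qed.

(** Successive upcrossings at dyadic times of arbitrary, unrelated levels; oscillation of a path
    produces these directly, before any grid is fixed. *)
Fixpoint alternates (R : realType) (phi : R -> R) (a b : R) (k : nat) (lo hi : R) : Prop :=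
  match k with
  | 0 => True
  | j.+1 => exists s t, [/\ dyadic s, dyadic t, lo < s & s < t] /\
      [/\ t < hi, phi s <= a, b <= phi t & alternates phi a b j t hi]
  end.

Definition grid (R : realType) (phi : R -> R) (m : nat) : nat -> R :=
  fun i => phi (i%:R / 2 ^+ m).

Lemma dyadic_level (R : realType) (q : R) : dyadic q ->
  exists n, forall m, (n <= m)%N -> exists i : nat, q = i%:R / 2 ^+ m.
Proof.
move=> [n [i ->]]; exists n => m nm; exists (i * 2 ^ (m - n))%N.
rewrite -{2}(subnKC nm) exprD natrM natrX.
by field; rewrite !expf_neq0// pnatr_eq0.
Qed.

(** The finitely many times involved lie on every sufficiently fine grid; there the trader holds at
    each low time and no longer holds at the following high time, so a sale occurs in between. *)
Lemma alternates_upcross (R : realType) (phi : R -> R) (a b lo hi : R) k :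
  a < b -> lo < hi -> alternates phi a b k lo hi ->
  exists m0, forall m, (m0 <= m)%N -> forall i n : nat,
    i%:R <= lo * 2 ^+ m -> hi * 2 ^+ m <= n%:R ->
    (upcross a b (grid phi m) i + k <= upcross a b (grid phi m) n)%N.
Proof.
move=> ab; elim: k lo => [|k IH] lo lohi /=.
  move=> _; exists 0%N => m _ i n il hn; rewrite addn0 upcross_mono//.
  rewrite -(ler_nat R) (le_trans il)// (le_trans _ hn)//.
  by rewrite ler_wpM2r ?ltW ?pow2_gt0.
move=> [s [t [[ds dt los st] [thi phis phit altk]]]].
have [m1 h1] := IH t thi altk.
have [m2 h2] := dyadic_level ds; have [m3 h3] := dyadic_level dt.
exists (maxn m1 (maxn m2 m3)) => m; rewrite !geq_max => /and3P[m1m m2m m3m] i n il hn.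
have [is_ es] := h2 _ m2m; have [it et] := h3 _ m3m.
have P0 := pow2_gt0 R m.
have P1 : (2 : R) ^+ m != 0 by rewrite gt_eqF.
have etn : t * 2 ^+ m = it%:R by rewrite et divfK.
have esn : s * 2 ^+ m = is_%:R by rewrite es divfK.
have iis : (i <= is_)%N.
  by rewrite -(ler_nat R) (le_trans il)// -esn ler_wpM2r ?ltW.
have isit : (is_ <= it)%N.
  by rewrite -(ler_nat R) -etn -esn ler_wpM2r ?ltW.
(* The induction restarts at the grid index of [t], which is why the starting index is arbitrary in
   the statement. *)
have := h1 m m1m it n; rewrite etn lexx => /(_ isT hn).
have sell : (upcross a b (grid phi m) is_ < upcross a b (grid phi m) it)%N.
  apply: upcross_sell => //; first by apply: hold_low; rewrite // /grid -es.
  by apply: hold_high; rewrite // /grid -et.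
move=> /(leq_trans _); apply; rewrite addnS -addSn leq_add2r.
exact: leq_ltn_trans (upcross_mono _ _ _ iis) sell.
Qed.

(** * Absence of oscillation implies convergence *)

Definition frequently (I : Type) (F : set_system I) (Q : set I) : Prop :=
  forall A, F A -> exists2 q, A q & Q q.

Lemma not_frequently (I : Type) (F : set_system I) (Q : set I) :
  Filter F -> ~ frequently F Q -> F (~` Q).
Proof.
move=> FF; apply: contra_notP => nF A FA; apply: contrapT => h; apply: nF.
by apply: filterS FA => q Aq Qq; apply: h; exists q.
Qed.

(** Boundedness gives a cluster point [p]. If [phi] does not converge to it, then [phi] is
    frequently near [p] and frequently at distance at least [e] on one side, so it oscillates across
    two dyadic levels placed in between. *)
Lemma cvg_no_oscillation (R : realType) (F : set_system R) (phi : R -> R) (C : R) :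
  ProperFilter F -> F [set q | 0 <= phi q <= C] ->
  (forall a b, dyadic a -> dyadic b -> a < b ->
    frequently F [set q | phi q <= a] -> frequently F [set q | b <= phi q] -> False) ->
  exists l : R, phi @ F --> l.
Proof.
move=> PF FC osc.
have [p p0 clp] : exists2 p : R, 0 <= p & cluster (phi @ F) p.
  have [|p [/= pC clp]] := @segment_compact R 0 C (phi @ F) _.
    suff : F [set q | phi q \in `[0, C]] by [].
    by apply: filterS FC => q /=; rewrite in_itv.
  by exists p => //; move: pC; rewrite in_itv => /andP[].
have near (e : R) : 0 < e -> frequently F [set q | `|phi q - p| < e].
  move=> e0 A FA; have FA' : (phi @ F) (phi @` A).
    suff : F [set q | (phi @` A) (phi q)] by [].
    by apply: filterS FA => q Aq; exists q.
  have [z [[q Aq <-] /= h]] := clp _ _ FA' (nbhsx_ballx p e e0).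
  by exists q => //=; rewrite distrC.
exists p; apply/cvgrPdist_lt => e e0.
apply: contrapT => nF.
have far : frequently F [set q | e <= `|p - phi q|].
  move=> A FA; apply: contrapT => h; apply: nF; apply: filterS FA => q Aq.
  by rewrite ltNge; apply/negP => hq; apply: h; exists q.
have [up|nup] := pselect (frequently F [set q | p + e <= phi q]).
  have [||a [da ap ae]] := @dyadic_dense R (p + e / 3) (p + e / 2); try lra.
  have [||b [db bp be]] := @dyadic_dense R (p + e / 2) (p + e); try lra.
  apply: (osc a b) => //; first lra.
    move=> A FA; have [|q Aq /= hq] := near (e / 3) _ A FA; first lra.
    by exists q => //=; move: hq; rewrite ltr_norml; lra.
  by move=> A FA; have [q Aq /= hq] := up A FA; exists q => //=; lra.
have down : frequently F [set q | phi q <= p - e].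
  move=> A FA; have [q [Aq nq] /= hq] := far _ (filterI FA (not_frequently _ nup)).
  exists q => //=; move: nq hq => /= /negP; rewrite -ltNge => nq.
  by rewrite ler_normr; lra.
(* Dyadic levels are nonnegative, so finding them above [p - e] requires this; it holds because
   [phi] takes nonnegative values there. *)
have pe : e <= p.
  have [q /= h1 h2] := down _ FC; lra.
have [||a [da ap ae]] := @dyadic_dense R (p - e) (p - 2 * e / 3); try lra.
have [||b [db bp be]] := @dyadic_dense R (p - 2 * e / 3) (p - e / 3); try lra.
apply: (osc a b) => //; first lra.
  by move=> A FA; have [q Aq /= hq] := down A FA; exists q => //=; lra.
move=> A FA; have [|q Aq /= hq] := near (e / 3) _ A FA; first lra.
by exists q => //=; move: hq; rewrite ltr_norml; lra.
Qed.

Lemma alternatesS (R : realType) (phi : R -> R) (a b lo lo' hi : R) k :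
  lo' <= lo -> alternates phi a b k lo hi -> alternates phi a b k lo' hi.
Proof.
case: k => //= k ll [s [t [[ds dt los st] h]]]; exists s, t; split => //; split => //.
exact: le_lt_trans los.
Qed.

(** Times accumulate at [t] from the right, so each new upcrossing is inserted in front of the
    earlier ones, strictly after [t]. The right end [t + 1] is an arbitrary bound. *)
Lemma dright_alternates (R : realType) (phi : R -> R) (a b t : R) : 0 <= t ->
  frequently (dright t) [set q | phi q <= a] ->
  frequently (dright t) [set q | b <= phi q] ->
  forall k, exists lo, [/\ t < lo, lo < t + 1 & alternates phi a b k lo (t + 1)].
Proof.
move=> t0 fa fb; elim=> [|k [lo [tlo lot altk]]].
  by exists (t + 1 / 2); split => //; lra.
have [|q [dq /andP[tq qlo]] /= hq] := fb [set q | dyadic q /\ t < q < lo].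
  by apply/drightP; exists (lo - t); [rewrite subr_gt0|rewrite subrKC].
have [|s [ds /andP[ts sq]] /= hs] := fa [set s | dyadic s /\ t < s < q].
  by apply/drightP; exists (q - t); [rewrite subr_gt0|rewrite subrKC].
exists ((t + s) / 2); split; [lra|lra|].
exists s, q; split; first by split => //; lra.
split=> //; first lra.
by apply: alternatesS altk; exact: ltW.
Qed.

Lemma dleft_alternates (R : realType) (phi : R -> R) (a b t : R) : 0 < t ->
  frequently (dleft t) [set q | phi q <= a] ->
  frequently (dleft t) [set q | b <= phi q] ->
  forall k lo, lo < t -> alternates phi a b k lo t.
Proof.
move=> t0 fa fb; elim=> [//|k IH] lo lot.
have [|s [ds /andP[ts sq]] /= hs] := fa [set s | dyadic s /\ lo < s < t].
  by apply/dleftP; exists (t - lo); [rewrite subr_gt0|rewrite subKr].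
have [|q [dq /andP[tq qlo]] /= hq] := fb [set q | dyadic q /\ s < q < t].
  by apply/dleftP; exists (t - s); [rewrite subr_gt0|rewrite subKr].
exists s, q; split; first by split.
by split => //; exact: IH.
Qed.

(** The grid of mesh [2 ^- m] is followed over the time interval from 0 to [m]. The added [a]
    compensates the possible loss on an open position, so for nonnegative [phi] and [0 <= a < b] the
    value dominates [b - a] times the number of upcrossings. *)
Definition dyadic_gain (R : realType) (a b : R) (phi : R -> R) (m : nat) : R :=
  gain a b (grid phi m) (m * 2 ^ m) + a.

Lemma alternates_dyadic_gain (R : realType) (phi : R -> R) (a b lo hi : R) k :
  0 <= a -> a < b -> (forall q, 0 <= q -> 0 <= phi q) -> 0 <= lo -> lo < hi ->
  alternates phi a b k lo hi ->
  \forall m \near \oo, (b - a) * k%:R <= dyadic_gain a b phi m.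
Proof.
move=> a0 ab phi0 lo0 lohi /(alternates_upcross ab lohi)[m0 h].
near=> m.
have phi0' i : 0 <= grid phi m i.
  by apply: phi0; rewrite divr_ge0// ltW// pow2_gt0.
apply: le_trans (gain_ge _ a0 ab phi0').
apply: ler_wpM2l; [by rewrite subr_ge0 ltW|rewrite ler_nat].
have := h m _ 0%N (m * 2 ^ m)%N; rewrite mulr_ge0 ?pow2_ge0//.
rewrite {1}/upcross big_ord0 add0n; apply => //; first by near: m; exists m0.
rewrite natrM natrX; apply: ler_wpM2r; first exact: pow2_ge0.
by near: m; exact: nbhs_infty_ger.
Unshelve. all: by end_near. Qed.

Lemma regulated_of_gain (R : realType) (phi : R -> R) (C : R) :
  (forall q, 0 <= q -> 0 <= phi q) -> (forall q, dyadic q -> phi q <= C) ->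
  (forall a b, dyadic a -> dyadic b -> a < b ->
    limn_einf (fun m => (dyadic_gain a b phi m)%:E) != +oo%E) ->
  regulated phi.
Proof.
move=> phi0 phiC h.
have key a b : dyadic a -> dyadic b -> a < b ->
    (forall k, exists lo hi, [/\ 0 <= lo, lo < hi & alternates phi a b k lo hi]) -> False.
  move=> da db ab hk; have /eqP := h a b da db ab; apply.
  (* Arbitrarily many upcrossings make the gains tend to infinity, contrary to the hypothesis on the
     lower limit. *)
  apply: (cvg_limn_einf_sup _).1; apply/cvgeryP/cvgryPge => A.
  have [k hk'] : exists k : nat, A <= (b - a) * k%:R.
    exists (Num.trunc (`|A| / (b - a))).+1.
    rewrite mulrC -ler_pdivrMr ?subr_gt0//.
    rewrite (le_trans _ (ltW (truncnS_gt _)))//.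
    by rewrite ler_pM2r ?invr_gt0 ?subr_gt0// ler_norm.
  have [lo [hi [lo0 lohi altk]]] := hk k.
  have := alternates_dyadic_gain (dyadic_ge0 da) ab phi0 lo0 lohi altk.
  by apply: filterS => m; exact: le_trans.
split=> t t0.
- have pf := dright_proper t0; apply: (@cvg_no_oscillation R _ phi C) => //.
    apply/drightP; exists 1 => // q dq _ /=.
    by rewrite phi0 ?phiC// dyadic_ge0.
  move=> a b da db ab fa fb; apply: (key a b) => // k.
  have [lo [tlo lot altk]] := dright_alternates t0 fa fb k.
  by exists lo, (t + 1); split => //; rewrite (le_trans t0) ?ltW.
- have pf := dleft_proper t0; apply: (@cvg_no_oscillation R _ phi C) => //.
    apply/dleftP; exists 1 => // q dq _ /=.
    by rewrite phi0 ?phiC// dyadic_ge0.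
  move=> a b da db ab fa fb; apply: (key a b) => // k.
  by exists 0, t; split => //; exact: dleft_alternates.
Qed.

(** * Nonnegative supermartingales in continuous time *)

Definition filtration (d : measure_display) (T : measurableType d) (R : realType)
    (F : R -> set (set T)) : Prop :=
  [/\ forall t, 0 <= t -> sigma_algebra setT (F t),
      forall t, 0 <= t -> F t `<=` measurable &
      forall s t, 0 <= s <= t -> F s `<=` F t].

(** The conditional inequality is expressed by integrals over events of the past, which avoids
    choosing conditional expectations. *)
Definition nonneg_supermartingale (d : measure_display) (T : measurableType d)
    (R : realType) (mu : probability T R) (F : R -> set (set T)) (X : R -> T -> R) : Prop :=
  [/\ forall t w, 0 <= t -> 0 <= X t w,
      forall t, 0 <= t -> Gmeas (F t) (X t),
      forall t, 0 <= t -> mu.-integrable setT (EFin \o X t) &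
      forall s t, 0 <= s <= t -> forall A, F s A ->
        (\int[mu]_(w in A) (X t w)%:E <= \int[mu]_(w in A) (X s w)%:E)%E].

Lemma sigma_algebra_setI (T : Type) (G : set (set T)) (A B : set T) :
  sigma_algebra setT G -> G A -> G B -> G (A `&` B).
Proof. by move/sigma_algebraP => /(_ (fun _ _ _ _ => I))[_ _ _]; exact. Qed.

Lemma sigma_algebra_setC (T : Type) (G : set (set T)) (A : set T) :
  sigma_algebra setT G -> G A -> G (~` A).
Proof. by move=> [_ + _] => /[apply]; rewrite setTD. Qed.

Lemma sigma_algebra_setU (T : Type) (G : set (set T)) (A B : set T) :
  sigma_algebra setT G -> G A -> G B -> G (A `|` B).
Proof.
move=> sG GA GB; rewrite -[A `|` B]setCK setCU.
by apply: sigma_algebra_setC => //; apply: sigma_algebra_setI => //; exact: sigma_algebra_setC.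
Qed.

Lemma hold_adapted (T : Type) (R : realType) (F : R -> set (set T)) (X : R -> T -> R)
    (t : nat -> R) (a b : R) :
  (forall s, 0 <= s -> sigma_algebra setT (F s)) ->
  (forall r s, 0 <= r <= s -> F r `<=` F s) ->
  (forall s, 0 <= s -> Gmeas (F s) (X s)) ->
  (forall i, 0 <= t i) -> (forall i, t i <= t i.+1) ->
  forall n, F (t n) [set w | hold a b (fun i => X (t i) w) n].
Proof.
move=> sF mF mX t0 tS; elim => [|n IH] /=.
  have := mX _ (t0 0%N) `]-oo, a]%classic (measurable_itv _).
  by congr (F _ _); apply/seteqP; split => w /=; rewrite in_itv.
have FF : F (t n.+1) [set w | hold a b (fun i => X (t i) w) n].
  by apply: mF IH; rewrite t0 tS.
have Fa : F (t n.+1) [set w | X (t n.+1) w <= a].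
  have := mX _ (t0 n.+1) `]-oo, a]%classic (measurable_itv _).
  by congr (F _ _); apply/seteqP; split => w /=; rewrite in_itv.
have Fb : F (t n.+1) [set w | X (t n.+1) w < b].
  have := mX _ (t0 n.+1) `]-oo, b[%classic (measurable_itv _).
  by congr (F _ _); apply/seteqP; split => w /=; rewrite in_itv.
have := sigma_algebra_setU (sF _ (t0 n.+1))
  (sigma_algebra_setI (sF _ (t0 n.+1)) FF Fb)
  (sigma_algebra_setI (sF _ (t0 n.+1)) (sigma_algebra_setC (sF _ (t0 n.+1)) FF) Fa).
congr (F _ _); apply/seteqP; split => w /=.
  by move=> [[-> //]|[/negP/negbTE -> //]].
by case: ifP => h xa; [left|right].
Qed.

(** Each summand is an increment restricted to the event that the trader holds; this event belongs
    to the past, so the supermartingale inequality applies to it. *)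
Lemma integrable_gain_le0 (d : measure_display) (T : measurableType d) (R : realType)
    (mu : probability T R) (F : R -> set (set T)) (X : R -> T -> R)
    (t : nat -> R) (a b : R) n :
  filtration F -> nonneg_supermartingale mu F X ->
  (forall i, 0 <= t i) -> (forall i, t i <= t i.+1) ->
  mu.-integrable setT (fun w => (gain a b (fun i => X (t i) w) n)%:E) /\
  (\int[mu]_w (gain a b (fun i => X (t i) w) n)%:E <= 0)%E.
Proof.
move=> [sF Fm mF] [X0 mX iX sX] t0 tS.
pose H i := [set w | hold a b (fun i => X (t i) w) i].
have FH i : F (t i) (H i) by exact: (@hold_adapted T R F X t a b).
have mH i : measurable (H i) by apply: Fm (FH i).
pose f i w := ((hold a b (fun i => X (t i) w) i)%:R * (X (t i.+1) w - X (t i) w))%:E.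
have fE i : f i = (fun w => ((X (t i.+1) w)%:E - (X (t i) w)%:E)%E) \_ (H i).
  apply/funext => w; rewrite /f patchE; case: ifPn.
    by rewrite inE /H /= => ->; rewrite mul1r.
  by move=> /negP; rewrite inE /H /= => /negP/negbTE ->; rewrite mul0r.
have iB i : mu.-integrable (H i) (fun w => ((X (t i.+1) w)%:E - (X (t i) w)%:E)%E).
  by apply: integrableB => //; apply: integrableS (iX _ _).
have fi i : mu.-integrable setT (f i).
  by rewrite fE; exact: (iffLR (integrable_mkcond _ (mH i)) (iB i)).
have gE : (fun w => (gain a b (fun i => X (t i) w) n)%:E) =
    (fun w => \sum_(i <- index_iota 0 n) f i w)%E.
  by apply/funext => w; rewrite /gain sumEFin big_mkord.
rewrite gE; split; first exact: integrable_sum.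
rewrite integral_sum//; apply: sume_le0 => i _.
rewrite fE -integral_mkcond integralB//; first last.
- by apply: integrableS (iX _ _).
- by apply: integrableS (iX _ _).
rewrite sube_le0; last by apply: sX; rewrite ?t0 ?tS.
Qed.

Lemma measurable_fun_limn_einf (d : measure_display) (T : measurableType d) (R : realType)
    (D : set T) (f : nat -> T -> \bar R) :
  (forall n, measurable_fun D (f n)) -> measurable_fun D (fun x => limn_einf (f^~ x)).
Proof.
move=> mf.
rewrite (_ : (fun x => _) = (fun x => - limn_esup (fun n => - f n x))%E).
  apply: measurableT_comp => //; apply: measurable_fun_limn_esup => n.
  exact: measurableT_comp.
apply/funext => x; rewrite -[LHS]oppeK -limn_esupN; congr (- limn_esup _)%E.
Qed.

(** Gains on successive grids need not be monotone, so the passage to the limit uses the lower limit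
    and Fatou's lemma; the bound [a] is what was added to a gain of nonpositive mean. *)
Lemma integral_dyadic_gain (d : measure_display) (T : measurableType d) (R : realType)
    (mu : probability T R) (F : R -> set (set T)) (X : R -> T -> R) (a b : R) :
  filtration F -> nonneg_supermartingale mu F X -> 0 <= a -> a < b ->
  [/\ measurable_fun setT (fun w => limn_einf (fun m => (dyadic_gain a b (X^~ w) m)%:E)),
     (forall w, 0 <= limn_einf (fun m => (dyadic_gain a b (X^~ w) m)%:E))%E &
     (\int[mu]_w limn_einf (fun m => (dyadic_gain a b (X^~ w) m)%:E) <= a%:E)%E].
Proof.
move=> fF sX a0 ab.
have X0 t w : 0 <= t -> 0 <= X t w by case: sX => + _ _ _ => /[apply]; exact.
have tm0 m (i : nat) : 0 <= i%:R / 2 ^+ m :> R by rewrite divr_ge0// pow2_ge0.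
have tmS m (i : nat) : i%:R / 2 ^+ m <= i.+1%:R / 2 ^+ m :> R.
  by rewrite ler_pM2r ?invr_gt0 ?pow2_gt0// ler_nat.
have ig m := integrable_gain_le0 a b (m * 2 ^ m) fF sX (tm0 m) (tmS m).
have g0 m w : 0 <= dyadic_gain a b (X^~ w) m.
  have x0 i : 0 <= grid (X^~ w) m i by exact: X0.
  apply: le_trans (gain_ge (m * 2 ^ m) a0 ab x0).
  by rewrite mulr_ge0// subr_ge0 ltW.
have ia m : mu.-integrable setT (fun w => (dyadic_gain a b (X^~ w) m)%:E).
  rewrite /dyadic_gain /grid; under eq_fun do rewrite EFinD.
  apply: integrableD => //; first exact: (ig m).1.
  exact: finite_measure_integrable_cst.
have mg m : measurable_fun setT (fun w => (dyadic_gain a b (X^~ w) m)%:E).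
  exact: measurable_int (ia m).
split.
- exact: measurable_fun_limn_einf.
- move=> w; rewrite limn_einf_lim; apply: lime_ge; first exact: is_cvg_einfs.
  by apply: nearW => n; apply: le_ereal_inf_tmp => _ [m _ <-]; rewrite lee_fin.
- apply: (le_trans (fatou mu measurableT mg _)).
    by move=> n w _; rewrite lee_fin.
  rewrite limn_einf_lim; apply: lime_le; first exact: is_cvg_einfs.
  apply: nearW => n; apply: ereal_inf_le.
  exists (\int[mu]_w (dyadic_gain a b (X^~ w) n)%:E)%E; first by exists n => /=.
  rewrite /dyadic_gain /grid; under eq_integral do rewrite EFinD.
  rewrite integralD//; [|exact: (ig n).1|exact: finite_measure_integrable_cst].
  have -> : (\int[mu]_(_ in setT) a%:E = a%:E)%E.
    rewrite (integral_cst mu measurableT a%:E) [X in (_ * X)%E](_ : _ = 1%E) ?mule1//.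
    exact: probability_setT.
  rewrite -[leRHS]add0e leeD2r//.
  exact: (ig n).2.
Qed.

(** A maximal inequality obtained from the same trader: a path that starts below [a] and exceeds
    [a + j.+1] completes an upcrossing worth [j.+1], so by Markov's inequality the event has
    probability at most [a / j.+1]. *)
Lemma supermartingale_bounded (d : measure_display) (T : measurableType d) (R : realType)
    (mu : probability T R) (F : R -> set (set T)) (X : R -> T -> R) :
  filtration F -> nonneg_supermartingale mu F X ->
  {ae mu, forall w, exists C, forall q, dyadic q -> X q w <= C}.
Proof.
move=> fF sX; have X0 t w : 0 <= t -> 0 <= X t w by case: sX => + _ _ _ => /[apply]; exact.
suff h (a : nat) : {ae mu, forall w, X 0 w <= a%:R ->
    exists C, forall q, dyadic q -> X q w <= C}.
  have := ae_foralln h; apply: filterS => w /(_ (Num.trunc (X 0 w)).+1).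
  by apply; exact/ltW/truncnS_gt.
pose L (j : nat) w := limn_einf (fun m =>
  (dyadic_gain a%:R (a%:R + j.+1%:R) (X^~ w) m)%:E).
have aj (j : nat) : a%:R < a%:R + j.+1%:R :> R by rewrite ltrDl.
have mL j := integral_dyadic_gain fF sX (ler0n R a) (aj j).
pose B := \bigcap_j [set w | (j.+1%:R%:E <= L j w)%E].
have mB j : measurable [set w | (j.+1%:R%:E <= L j w)%E].
  have [+ _ _] := mL j => /(emeasurable_fun_c_infty measurableT).
  by move=> /(_ j.+1%:R%:E); rewrite setTI; congr (measurable _); apply/seteqP; split => w /=.
have B0 : mu B = 0%E.
  have hB (j : nat) : (j.+1%:R%:E * mu B <= a%:R%:E)%E.
    have [m1 L0 iL] := mL j; apply: le_trans iL.
    have := @le_integral_abse _ _ _ mu setT measurableT _ j.+1%:R m1 (ltr0Sn _ _).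
    under eq_integral do rewrite gee0_abs//.
    apply: le_trans; rewrite lee_pmul2l// setTI.
    apply: le_measure; rewrite ?inE//; first exact: bigcapT_measurable.
      rewrite [X in measurable X](_ : _ = [set w | (j.+1%:R%:E <= L j w)%E])//.
      by apply/seteqP; split => w /=; rewrite gee0_abs.
    by move=> w /(_ j I) /=; rewrite gee0_abs.
  have muB : mu B \is a fin_num by rewrite fin_num_measure//; exact: bigcapT_measurable.
  apply/eqP; rewrite eq_le measure_ge0 andbT -(fineK muB) lee_fin leNgt.
  apply/negP => B1.
  have := hB (Num.trunc (a%:R / fine (mu B))).
  rewrite -(fineK muB) -EFinM lee_fin -ler_pdivlMr// leNgt => /negP; apply.
  exact: truncnS_gt.
exists B; split => //; first exact: bigcapT_measurable.
move=> w /= /not_implyP[Xa nC] j _ /=.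
have [q dq Xq] : exists2 q, dyadic q & a%:R + j.+1%:R < X q w.
  apply: contrapT => h; apply: nC; exists (a%:R + j.+1%:R) => q dq.
  by rewrite leNgt; apply/negP => hq; apply: h; exists q.
have q0 := dyadic_ge0 dq.
have [m0 hm0] := dyadic_level dq.
rewrite /L limn_einf_lim; apply: lime_ge; first exact: is_cvg_einfs.
(* For large [m] the grid contains [q] and reaches beyond it; the trader buys at time 0 and has sold
   by time [q]. *)
near=> n; apply: le_ereal_inf_tmp => _ [m /= nm <-]; rewrite lee_fin.
have [|i ei] := hm0 m; first by rewrite (leq_trans _ nm)//; near: n; exists m0.
have x0 k : 0 <= grid (X^~ w) m k by apply: X0; rewrite divr_ge0// pow2_ge0.
apply: le_trans (gain_ge (m * 2 ^ m) (ler0n R a) (aj j) x0).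
rewrite [X in X * _]addrC addKr ler_peMr//; rewrite -[1]/(1%:R) ler_nat.
have im : (i <= m * 2 ^ m)%N.
  rewrite -(ler_nat R) natrM natrX -ler_pdivrMr ?pow2_gt0// -ei.
  by rewrite (@le_trans _ _ n%:R) ?ler_nat//; near: n; exact: nbhs_infty_ger.
apply: leq_trans (upcross_mono _ _ _ im).
apply: leq_ltn_trans (upcross_sell (leq0n i) _ _) => //.
  by apply: hold_low => //; rewrite /grid mul0r.
by apply: hold_high => //; rewrite /grid -ei ltW.
Unshelve. all: by end_near. Qed.

Theorem supermartingale_regulated (d : measure_display) (T : measurableType d) (R : realType)
    (mu : probability T R) (F : R -> set (set T)) (X : R -> T -> R) :
  filtration F -> nonneg_supermartingale mu F X ->
  {ae mu, forall w, regulated (X^~ w)}.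
Proof.
move=> fF sX; have X0 t w : 0 <= t -> 0 <= X t w by case: sX => + _ _ _ => /[apply]; exact.
(* The pairs of dyadic levels are written with four natural numbers so that the exceptional sets
   form a countable family. *)
have h (n i m j : nat) : {ae mu, forall w, i%:R / 2 ^+ n < j%:R / 2 ^+ m :> R ->
    limn_einf (fun k => (dyadic_gain (i%:R / 2 ^+ n) (j%:R / 2 ^+ m) (X^~ w) k)%:E) != +oo%E}.
  have [ab|ab] := pselect ((i%:R / 2 ^+ n : R) < j%:R / 2 ^+ m); last first.
    by apply: aeW => w.
  have a0 : 0 <= i%:R / 2 ^+ n :> R by rewrite divr_ge0// pow2_ge0.
  have [mL L0 iL] := integral_dyadic_gain fF sX a0 ab.
  have intL : mu.-integrable setT (fun w =>
      limn_einf (fun k => (dyadic_gain (i%:R / 2 ^+ n) (j%:R / 2 ^+ m) (X^~ w) k)%:E)).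
    apply/integrableP; split => //; under eq_integral do rewrite gee0_abs//.
    by rewrite (le_lt_trans iL)// ltry.
  have := integrable_ae measurableT intL; apply: filterS => w /(_ I) + _.
  by move=> /fin_numP[].
have := ae_foralln (fun n => ae_foralln (fun i => ae_foralln (fun m =>
  ae_foralln (fun j => h n i m j)))).
have := supermartingale_bounded fF sX.
apply: filterS2 => w [C hC] hw; apply: (@regulated_of_gain _ _ C) => //.
  by move=> q q0; exact: X0.
by move=> a b [n [i ->]] [m [j ->]]; exact: hw.
Qed.

(** * Weighted spaces *)

(** Compactness as an induction principle, in place of finite subcovers: the sets [A] for which [Q]
    holds of [K] minus [A] form a filter, and if [Q K] failed this filter would be proper and have a
    cluster point in [K], where [Q] holds locally. *)
Lemma compact_ind (E : topologicalType) (K : set E) (Q : set E -> Prop) :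
  compact K -> Q set0 -> (forall A B, A `<=` B -> Q B -> Q A) ->
  (forall A B, Q A -> Q B -> Q (A `|` B)) ->
  (forall x, K x -> exists2 U, nbhs x U & Q (U `&` K)) -> Q K.
Proof.
move=> cK Q0 QS QU Qx; apply: contrapT => nQ.
pose F : set_system E := [set A | Q (K `\` A)].
have FF : Filter F.
  split; rewrite /F /=; first by rewrite setDT.
    by move=> A B /= QA QB; rewrite setDIr; exact: QU.
  by move=> A B AB; apply: QS; exact: setDS.
have PF : ProperFilter F by apply: Build_ProperFilter; rewrite /F /= setD0.
have [|x [Kx clx]] := cK F PF; first by rewrite /F /= setDv.
have [U Ux QUK] := Qx x Kx.
have FU : F (~` U) by rewrite /F /= setDE setCK setIC.
by have [z [+ Uz]] := clx _ _ FU Ux; exact.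
Qed.

Lemma continuous_within_cont (E V : topologicalType) (K : set E) (f : E -> V) :
  continuous f -> within_cont K f.
Proof.
move=> cf x _ A /(cf x) hA.
have {}hA : nbhs x (f @^-1` A) := hA.
suff : nbhs x [set z | K z -> A (f z)] by [].
by apply: filterS hA => z Az _; exact: Az.
Qed.

Lemma Cb_cst (R : realType) (E : topologicalType) (c : R) : Cb (fun _ : E => c).
Proof. by split; [exact: cst_continuous|exists `|c|]. Qed.

Lemma Cb_lin (R : realType) (E : topologicalType) (a b : R) (f g : E -> R) :
  Cb f -> Cb g -> Cb (fun x => a * f x + b * g x).
Proof.
move=> [cf [C hC]] [cg [D hD]]; split.
  move=> x; apply: cvgD.
    by apply: cvgM; [exact: cvg_cst|exact: cf].
  by apply: cvgM; [exact: cvg_cst|exact: cg].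
exists (`|a| * C + `|b| * D) => x; rewrite (le_trans (ler_normD _ _))// !normrM.
by apply: lerD; apply: ler_wpM2l.
Qed.

Lemma Cb_min (R : realType) (E : topologicalType) (f g : E -> R) :
  Cb f -> Cb g -> Cb (fun x => Num.min (f x) (g x)).
Proof.
move=> [cf [C hC]] [cg [D hD]]; split; first exact: min_fun_continuous.
exists (Num.max C D) => x; rewrite le_max.
by case: (leP (f x) (g x)) => _; rewrite ?hC ?hD ?orbT.
Qed.

Lemma Cb_max (R : realType) (E : topologicalType) (f g : E -> R) :
  Cb f -> Cb g -> Cb (fun x => Num.max (f x) (g x)).
Proof.
move=> [cf [C hC]] [cg [D hD]]; split; first exact: max_fun_continuous.
exists (Num.max C D) => x; rewrite le_max.
by case: (leP (f x) (g x)) => _; rewrite ?hC ?hD ?orbT.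
Qed.

Lemma separating_function (R : realType) (E : topologicalType) (x y : E) :
  completely_regular_space E -> hausdorff_space E -> x <> y ->
  exists f : E -> R, [/\ Cb f, f x = 0 & f y = 1].
Proof.
move=> crE hE xy.
have [||f [cf f01 fx fy]] := (@uniform_separatorP E R [set x] [set y]).1 (crE x [set y] _ _).
- exact/accessible_closed_set1/hausdorff_accessible.
- by move=> /= exy; apply: xy.
exists f; split.
- split=> //; exists 1 => z; have /= := f01 (f z) (ex_intro2 _ _ z I erefl).
  by rewrite in_itv/= => /andP[? ?]; rewrite ger0_norm.
- by apply: fx; exists x.
- by apply: fy; exists y.
Qed.

Lemma within_cont_near (R : realType) (E : topologicalType) (K : set E) (u : E -> R) x c :
  within_cont K u -> K x -> u x < c ->
  exists2 U, nbhs x U & forall z, U z -> K z -> u z < c.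
Proof.
move=> cu Kx ux; have h : \forall t \near within K (nbhs x), u t < c.
  by apply: (cvgr_lt (u x)) => //; exact: cu.
by exists [set z | K z -> u z < c].
Qed.

Lemma within_contB (R : realType) (E : topologicalType) (K : set E) (u v : E -> R) :
  within_cont K u -> within_cont K v -> within_cont K (fun x => u x - v x).
Proof. by move=> cu cv x Kx; apply: cvgB; [exact: cu|exact: cv]. Qed.

(** The lattice form of the Stone-Weierstrass theorem. As the approximants live on all of [E], it
    also does the work of an extension theorem from [K]. *)
Lemma lattice_approximation (R : realType) (E : topologicalType) (K : set E) (h : E -> R) (e : R) :
  completely_regular_space E -> hausdorff_space E -> compact K -> within_cont K h -> 0 < e ->
  exists f, Cb f /\ forall z, K z -> `|f z - h z| < e.
Proof.
move=> crE hE cK ch e0.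
have two x y : exists f, [/\ Cb f, f x = h x & f y = h y].
  have [<-|xy] := pselect (x = y); first by exists (fun=> h x); split => //; exact: Cb_cst.
  have [f [cf fx fy]] := @separating_function R E x y crE hE xy.
  exists (fun z => (h y - h x) * f z + h x * 1); split.
  - by apply: Cb_lin => //; exact: Cb_cst.
  - by rewrite fx; ring.
  - by rewrite fy; ring.
(* Minima of two-point interpolants push the function below [h + e] while keeping its value at [x];
   maxima over [x] then restore the lower bound. *)
have one x : K x -> exists f, [/\ Cb f, f x = h x & forall z, K z -> f z < h z + e].
  move=> Kx; apply: (@compact_ind E K (fun A => exists f,
    [/\ Cb f, f x = h x & forall z, A z -> f z < h z + e])) => //.
  - by exists (fun=> h x); split => //; exact: Cb_cst.
  - by move=> A B AB [f [cf fx hf]]; exists f; split => // z /AB; exact: hf.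
  - move=> A B [f [cf fx hf]] [g [cg gx hg]].
    exists (fun z => Num.min (f z) (g z)); split => //; first exact: Cb_min.
      by rewrite fx gx minxx.
    by move=> z [/hf|/hg] hz; rewrite gt_min hz ?orbT.
  - move=> y Ky; have [f [cf fx fy]] := two x y.
    have [||U Uy hU] := @within_cont_near R E K (fun z => f z - h z) y e _ Ky _.
      by apply: within_contB => //; apply: continuous_within_cont; case: cf.
      by rewrite fy subrr.
    exists U => //; exists f; split => // z [Uz Kz].
    by have := hU z Uz Kz; rewrite ltrBlDl.
suff [f [cf hf1 hf2]] : exists f, [/\ Cb f, forall z, K z -> f z < h z + e &
    forall z, K z -> h z - e < f z].
  exists f; split => // z Kz; have := hf1 z Kz; have := hf2 z Kz.
  by rewrite ltr_norml; lra.
have [[x0 Kx0]|K0] := pselect (K !=set0); last first.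
  by exists (fun=> 0); split => [|z Kz|z Kz]; [exact: Cb_cst| |];
    exfalso; apply: K0; exists z.
apply: (@compact_ind E K (fun A => exists f, [/\ Cb f, forall z, K z -> f z < h z + e &
    forall z, A z -> h z - e < f z])) => //.
- by have [f [cf fx hf]] := one x0 Kx0; exists f; split.
- by move=> A B AB [f [cf hf1 hf2]]; exists f; split => // z /AB; exact: hf2.
- move=> A B [f [cf hf1 hf2]] [g [cg hg1 hg2]].
  exists (fun z => Num.max (f z) (g z)); split => //; first exact: Cb_max.
    by move=> z Kz; rewrite gt_max hf1// hg1.
  by move=> z [/hf2|/hg2] hz; rewrite lt_max hz ?orbT.
- move=> x Kx; have [f [cf fx hf]] := one x Kx.
  have [||U Ux hU] := @within_cont_near R E K (fun z => h z - f z) x e _ Kx _.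
    by apply: within_contB => //; apply: continuous_within_cont; case: cf.
    by rewrite fx subrr.
  exists U => //; exists f; split => // z [Uz Kz].
  by have := hU z Uz Kz; lra.
Qed.

Section weighted.
Context (R : realType) (E : ptopologicalType) (rho : E -> R).
Hypothesis ws : weighted_space rho.
Implicit Types f g : E -> R.

Let crE : completely_regular_space E := ws.1.
Let hE : hausdorff_space E := ws.2.1.
Let rho_gt0 : forall x, 0 < rho x := ws.2.2.1.
Let compact_sublevel : forall r : R, 0 <= r -> compact [set x | rho x <= r] := ws.2.2.2.

(** Lower semicontinuity of the weight: compact sublevel sets are closed in a Hausdorff space. *)
Lemma weight_open_gt (r : R) : open [set x | r < rho x].
Proof.
have [r0|r0] := leP 0 r; last first.
  rewrite (_ : [set x | _] = setT); first exact: openT.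
  by apply/seteqP; split => // x _ /=; exact: lt_trans (rho_gt0 x).
rewrite (_ : [set x | _] = ~` [set x | rho x <= r]).
  by apply: closed_openC; apply: (compact_closed hE); exact: compact_sublevel.
by apply/seteqP; split => x /=; [move=> h; apply/negP; rewrite -ltNge|move/negP; rewrite -ltNge].
Qed.

Lemma weight_lower_bound : exists2 c, 0 < c & forall x, c <= rho x.
Proof.
suff [c c0 hc] : exists2 c, 0 < c & forall x, rho x <= 1 -> c <= rho x.
  exists (Num.min c 1); first by rewrite lt_min c0 ltr01.
  move=> x; have [/hc|/ltW] := leP (rho x) 1; first by rewrite ge_min => ->.
  by rewrite ge_min => ->; rewrite orbT.
apply: (@compact_ind E [set x | rho x <= 1] (fun A => exists2 c, 0 < c & forall x, A x -> c <= rho x)).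
- exact: compact_sublevel.
- by exists 1.
- by move=> A B AB [c c0 hc]; exists c => // x /AB; exact: hc.
- move=> A B [c c0 hc] [c' c0' hc']; exists (Num.min c c'); first by rewrite lt_min c0.
  by move=> x [/hc|/hc'] h; rewrite ge_min h ?orbT.
- move=> x _; exists [set y | rho x / 2 < rho y].
    apply: open_nbhs_nbhs; split; first exact: weight_open_gt.
    by rewrite /= ltr_pdivrMr// ltr_pMr// ltr1n.
  by exists (rho x / 2); [exact: divr_gt0|move=> y [/ltW]].
Qed.

Lemma rho_norm_leP f (C : R) :
  (rho_norm rho f <= C%:E)%E <-> forall x, `|f x| <= C * rho x.
Proof.
split=> h.
  move=> x; rewrite -ler_pdivrMr// -lee_fin; apply: le_trans h.
  by apply: ereal_sup_ubound; exists x.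
by apply: ge_ereal_sup => _ [x _ <-]; rewrite lee_fin ler_pdivrMr.
Qed.

(** The finite norm is recovered from a bounded approximant at distance 1, since a weight bounded
    away from 0 dominates bounded functions up to a factor. *)
Lemma BrhoP f : Brho rho f <->
  forall e : R, 0 < e -> exists g, Cb g /\ forall x, `|f x - g x| <= e * rho x.
Proof.
split=> [[_ h] e /h[g [cg /rho_norm_leP hg]]|h]; first by exists g.
split; last by move=> e /h[g [cg hg]]; exists g; split => //; apply/rho_norm_leP.
have [g [[_ [C hC]] hg]] := h 1 ltr01.
have [c c0 hc] := weight_lower_bound.
apply: (@le_lt_trans _ _ (1 + `|C| / c)%:E); last exact: ltry.
apply/rho_norm_leP => x; rewrite -[f x](subrK (g x)) (le_trans (ler_normD _ _))//.
rewrite mulrDl lerD ?hg// (le_trans (hC x))// (le_trans (ler_norm _))//.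
by rewrite -mulrA ler_peMr// ler_pdivlMl// mulr1.
Qed.

Lemma Brho_norm_fin f : Brho rho f -> exists C : R, [/\ 0 <= C,
  (rho_norm rho f <= C%:E)%E & forall x, `|f x| <= C * rho x].
Proof.
move=> [fy _]; suff [C C0 hC] : exists2 C : R, 0 <= C & (rho_norm rho f <= C%:E)%E.
  by exists C; split => //; exact/rho_norm_leP.
case: (rho_norm rho f) fy => [r _|//|_].
  by exists `|r| => //; rewrite lee_fin ler_norm.
by exists 0 => //; rewrite leNye.
Qed.

Lemma Cb_Brho f : Cb f -> Brho rho f.
Proof.
move=> cf; apply/BrhoP => e e0; exists f; split => // x.
by rewrite subrr normr0 mulr_ge0// ltW.
Qed.

Lemma Brho_lin (a b : R) f g : Brho rho f -> Brho rho g ->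
  Brho rho (fun x => a * f x + b * g x).
Proof.
move=> /BrhoP hf /BrhoP hg; apply/BrhoP => e e0.
pose d := e / (`|a| + `|b| + 1).
have d0 : 0 < d by rewrite divr_gt0// ltr_pwDr.
have [f' [cf hf']] := hf d d0; have [g' [cg hg']] := hg d d0.
exists (fun x => a * f' x + b * g' x); split; first exact: Cb_lin.
move=> x; have -> : a * f x + b * g x - (a * f' x + b * g' x) =
  a * (f x - f' x) + b * (g x - g' x) by ring.
rewrite (le_trans (ler_normD _ _))// !normrM.
apply: (@le_trans _ _ ((`|a| + `|b|) * (d * rho x))).
  by rewrite mulrDl; apply: lerD; apply: ler_wpM2l.
rewrite mulrA; apply: ler_wpM2r; first exact: ltW.
rewrite /d mulrA ler_pdivrMr ?ltr_pwDr// mulrC ler_pM2l//.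
by rewrite lerDl.
Qed.

Lemma Brho_lipschitz (phi : R -> R) f : (forall x y, `|phi x - phi y| <= `|x - y|) ->
  Brho rho f -> Brho rho (phi \o f).
Proof.
move=> lphi /BrhoP hf; apply/BrhoP => e /hf[g [[cg [C hC]] hg]].
exists (phi \o g); split; last by move=> x /=; exact: le_trans (lphi _ _) (hg x).
split.
  move=> x; apply/cvgrPdist_lt => d d0.
  have := cg x => /cvgrPdist_lt /(_ d d0); apply: filterS => z /=.
  exact: le_lt_trans.
exists (`|phi 0| + C) => x /=; rewrite -[phi (g x)](subrK (phi 0)) addrC.
rewrite (le_trans (ler_normD _ _))// lerD2l (le_trans (lphi _ _))//.
by rewrite subr0.
Qed.

Lemma Brho_closed f : (forall e : R, 0 < e -> exists g, Brho rho g /\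
  forall x, `|f x - g x| <= e * rho x) -> Brho rho f.
Proof.
move=> h; apply/BrhoP => e e0.
have e2 : 0 < e / 2 by rewrite divr_gt0.
have [g [/BrhoP bg hg]] := h _ e2; have [k [ck hk]] := bg _ e2.
exists k; split => // x; rewrite [e]splitr mulrDl.
by rewrite (le_trans (ler_distD (g x) _ _))// lerD.
Qed.

Lemma Brho_within_cont f (r : R) : 0 <= r -> Brho rho f ->
  within_cont [set x | rho x <= r] f.
Proof.
move=> r0 /BrhoP hf x Kx; apply/cvgrPdist_lt => e e0.
(* On the sublevel set this makes the approximation error at most [e / 3]; [r + 1] is positive even
   when [r = 0]. *)
have d0 : 0 < e / (3 * (r + 1)) by rewrite divr_gt0// mulr_gt0// ltr_wpDl.
have [g [[cg _] hg]] := hf _ d0.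
have hg' z : rho z <= r -> `|f z - g z| <= e / 3.
  move=> zr; rewrite (le_trans (hg z))//.
  apply: (@le_trans _ _ (e / (3 * (r + 1)) * (r + 1))).
    by apply: ler_wpM2l; [exact: ltW|rewrite (le_trans zr)// lerDl].
  by rewrite invfM mulrA divfK// gt_eqF// ltr_wpDl.
have e3 : 0 < e / 3 by rewrite divr_gt0.
have := cg x => /cvgrPdist_lt /(_ _ e3) h.
near=> z.
have zr : rho z <= r by near: z; exact: withinT.
have gz : `|g x - g z| < e / 3 by near: z; exact: cvg_within.
have := hg' z zr; have := hg' x Kx.
move: gz; rewrite ltr_norml !ler_norml ltr_norml; lra.
Unshelve. all: by end_near. Qed.

(** A converse to [Brho_within_cont] for bounded functions: an approximation is needed only on one
    compact sublevel set, because outside it the weight absorbs any error of size [2 * C]. *)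
Lemma bounded_within_cont_Brho f : (exists C, forall x, `|f x| <= C) ->
  (forall r : R, 0 <= r -> within_cont [set x | rho x <= r] f) -> Brho rho f.
Proof.
move=> [C hC] cf; apply/BrhoP => e e0.
have [c c0 hc] := weight_lower_bound.
have C0 : 0 <= C := le_trans (normr_ge0 _) (hC point).
(* Chosen so that [2 * C <= e * rho x] as soon as [rho x > r]. Inside, the error [e * c] is below
   [e * rho x]. *)
pose r := 2 * C / e.
have r0 : 0 <= r by rewrite divr_ge0// ?mulr_ge0// ltW.
have ec0 : 0 < e * c by rewrite mulr_gt0.
have [g [cg hg]] := lattice_approximation crE hE (compact_sublevel r0) (cf r r0) ec0.
exists (fun x => Num.max (- C) (Num.min C (g x))); split.
  apply: Cb_max; first exact: Cb_cst.
  by apply: Cb_min => //; exact: Cb_cst.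
move=> x; have := hC x; rewrite ler_norml => /andP[fC1 fC2].
have [xr|xr] := leP (rho x) r.
  apply: (@le_trans _ _ (e * c)); last by rewrite ler_pM2l.
  have := hg x xr; rewrite ltr_norml ler_norml => /andP[h1 h2].
  case: (leP C (g x)) => h3; first by rewrite max_r; lra.
  by case: (leP (- C) (g x)) => h4; lra.
apply: (@le_trans _ _ (2 * C)); last by rewrite -ler_pdivrMl// mulrC ltW.
rewrite ler_norml; case: (leP C (g x)) => h3; first by rewrite max_r; lra.
by case: (leP (- C) (g x)) => h4; lra.
Qed.

Lemma continuous_borel_measurable f : continuous f ->
  measurable_fun setT (f : borelE E -> R).
Proof.
move=> cf; apply: (measurability (@RGenOInfty.G R)).
  exact: RGenOInfty.measurableE.
move=> _ [_ [a ->] <-]; rewrite setTI; apply: sub_sigma_algebra.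
by apply: open_comp => [x _|]; [exact: cf|exact: rray_open].
Qed.

Lemma weight_borel_measurable : measurable_fun setT (rho : borelE E -> R).
Proof.
apply: (measurability (@RGenOInfty.G R)).
  exact: RGenOInfty.measurableE.
move=> _ [_ [a ->] <-]; rewrite setTI; apply: sub_sigma_algebra.
have := weight_open_gt a; congr (open _); apply/seteqP; split => x /=; by rewrite in_itv/= andbT.
Qed.

Lemma Brho_borel_measurable f : Brho rho f -> measurable_fun setT (f : borelE E -> R).
Proof.
move=> /BrhoP hf.
have /choice[g hg] : forall n, exists g : E -> R, Cb g /\
    forall x, `|f x - g x| <= n.+1%:R^-1 * rho x by move=> n; apply: hf; rewrite invr_gt0.
apply: (@measurable_fun_cvg _ (borelE E) R setT g f).
  by move=> n; apply: continuous_borel_measurable; case: (hg n) => -[].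
move=> x _; apply/cvgrPdist_le => e e0.
near=> n; rewrite (le_trans ((hg n).2 x))//.
rewrite ler_pdivrMl// -ler_pdivrMr//.
rewrite (@le_trans _ _ n%:R) ?ler_nat//; near: n; exact: nbhs_infty_ger.
Unshelve. all: by end_near. Qed.

(** Membership in a Baire set is decided by countably many continuous functions: the sets with this
    property form a sigma-algebra containing the generators. *)
Lemma baire_saturated (A : set E) : baire_sets R A ->
  exists g : nat -> E -> R, (forall i, continuous (g i)) /\
    forall x y, (forall i, g i x = g i y) -> A x -> A y.
Proof.
move: A; apply: smallest_sub.
- split.
  + by exists (fun _ _ => 0); split => // i; exact: cst_continuous.
  + move=> A [g [cg hg]]; exists g; split => // x y gxy [_ nA]; split => // Ay; apply: nA.
    by apply: hg Ay => i.
  + move=> A /choice[g hg].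
    exists (fun k => if unpickle k is Some (n, i) then g n i else fun=> 0); split.
      move=> k; case: unpickle => [[n i]|]; last exact: cst_continuous.
      exact: (hg n).1.
    move=> x y gxy [n _ Ax]; exists n => //; apply: ((hg n).2 x y) Ax => i.
    by have := gxy (pickle (n, i)); rewrite pickleK.
- move=> A [f [B [[cf _] [_ ->]]]]; exists (fun=> f); split => // x y fxy /=.
  by rewrite (fxy 0%N).
Qed.

(** [h n] is the distance to [K] for the continuous pseudometric built from the first [n] functions
    [g i]. A point outside [K] is separated from each point of [K] by some [g i], and compactness
    makes [n] and the distance uniform over [K]. *)
Lemma compact_saturated_zero_set (K : set E) (g : nat -> E -> R) :
  compact K -> (forall i, continuous (g i)) ->
  (forall x y, (forall i, g i x = g i y) -> K x -> K y) ->
  exists h : nat -> E -> R, [/\ forall n, continuous (h n), forall n x, 0 <= h n x,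
    forall n x, K x -> h n x = 0 & forall x, ~ K x -> exists n, 0 < h n x].
Proof.
move=> cK cg hg.
have [[x0 Kx0]|K0] := pselect (K !=set0); last first.
  exists (fun _ _ => 1); split => //; first by move=> n; exact: cst_continuous.
    by move=> n x Kx; exfalso; apply: K0; exists x.
  by move=> x _; exists 0%N.
pose d n x y := \sum_(i < n) `|g i x - g i y|.
have d0 n x y : 0 <= d n x y by apply: sumr_ge0.
have dxx n x : d n x x = 0 by rewrite /d big1// => i _; rewrite subrr normr0.
have dtri n x y z : d n x z <= d n x y + d n y z.
  by rewrite /d -big_split /=; apply: ler_sum => i _; exact: ler_distD.
have dC n x y : d n x y = d n y x by apply: eq_bigr => i _; rewrite distrC.
pose h n x := inf [set d n x y | y in K].
have hle n x y : K y -> h n x <= d n x y.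
  by move=> Ky; apply: ge_inf; [exists 0 => _ [z _ <-]|exists y].
have hge n x (c : R) : (forall y, K y -> c <= d n x y) -> c <= h n x.
  move=> hc; apply: lb_le_inf; first by exists (d n x x0), x0.
  by move=> _ [y Ky <-]; exact: hc.
have h0 n x : 0 <= h n x by apply: hge.
have cd n x : d n x y @[y --> x] --> 0.
  rewrite -(dxx n x) /d; elim: n => [|n IH].
    by under eq_fun do rewrite big_ord0; rewrite big_ord0; exact: cvg_cst.
  under eq_fun do rewrite big_ord_recr /=.
  rewrite big_ord_recr /=; apply: cvgD => //.
  by apply: cvg_norm; apply: cvgB; [exact: cvg_cst|exact: cg].
exists h; split => //.
- move=> n x; apply/cvgrPdist_le => e e0.
  have := cd n x => /cvgrPdist_le /(_ _ e0); apply: filterS => z.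
  rewrite sub0r normrN ger0_norm// => dz.
  have h1 : h n x <= d n x z + h n z.
    rewrite -lerBlDl; apply: hge => y Ky; rewrite lerBlDl (le_trans (hle n x y Ky))//.
  have h2 : h n z <= d n x z + h n x.
    by rewrite -lerBlDl; apply: hge => y Ky; rewrite lerBlDl dC (le_trans (hle n z y Ky)).
  by rewrite ler_norml; lra.
- by move=> n x Kx; apply/eqP; rewrite eq_le h0 -(dxx n x) hle.
- move=> x nKx.
  suff [n [c c0 hc]] : exists n, exists2 c, 0 < c & forall y, K y -> c <= d n x y.
    by exists n; rewrite (lt_le_trans c0)//; exact: hge.
  apply: (@compact_ind E K (fun A => exists n, exists2 c, 0 < c & forall y, A y -> c <= d n x y)) => //.
  + by exists 0%N, 1.
  + by move=> A B AB [n [c c0 hc]]; exists n, c => // y /AB; exact: hc.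
  + have dmono n m y : (n <= m)%N -> d n x y <= d m x y.
      move=> nm; rewrite /d -(subnKC nm) big_split_ord /= lerDl.
      by apply: sumr_ge0.
    move=> A B [n [c c0 hc]] [m [c' c0' hc']]; exists (maxn n m), (Num.min c c').
      by rewrite lt_min c0.
    move=> y [/hc|/hc'] hy; rewrite ge_min.
      by rewrite (le_trans hy)//; apply: dmono; exact: leq_maxl.
    by apply/orP; right; rewrite (le_trans hy)//; apply: dmono; exact: leq_maxr.
  + move=> y Ky.
    have [i gi] : exists i, g i x <> g i y.
      apply: contrapT => hn; apply: nKx; apply: (hg y x) => // i.
      by apply: contrapT => hi; apply: hn; exists i => /esym.
    have gi0 : 0 < `|g i x - g i y| by rewrite normr_gt0 subr_eq0; exact/eqP.
    exists [set z | `|g i x - g i y| / 2 < d i.+1 x z].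
      have := cg i y => /cvgrPdist_lt /(_ (`|g i x - g i y| / 2)).
      rewrite divr_gt0// => /(_ isT); apply: filterS => z hz /=.
      apply: (@lt_le_trans _ _ `|g i x - g i z|).
        have := ler_distD (g i z) (g i x) (g i y); rewrite (distrC (g i z)).
        by move: hz; lra.
      by rewrite /d big_ord_recr /= lerDr sumr_ge0.
    exists i.+1, (`|g i x - g i y| / 2); first by rewrite divr_gt0.
    by move=> z [/ltW].
Qed.

Lemma weight_approximation :
  (forall B : set R, measurable B -> @baire_sets R E (rho @^-1` B)) ->
  exists f : nat -> E -> R, [/\ forall k, Cb (f k), forall k x, 0 <= f k x <= rho x,
    forall k x, f k x <= f k.+1 x & forall x, f k x @[k --> \oo] --> rho x].
Proof.
move=> bm.
have /choice[h hh] : forall r : {r : R | 0 <= r}, exists h : nat -> E -> R,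
    [/\ forall n, continuous (h n), forall n x, 0 <= h n x,
    forall n x, rho x <= sval r -> h n x = 0 &
    forall x, ~ (rho x <= sval r) -> exists n, 0 < h n x].
  move=> [r r0] /=.
  have bK : baire_sets R [set x | rho x <= r].
    have := bm `]-oo, r]%classic (measurable_itv _); by congr (baire_sets _ _).
  have [g [cg hg]] := baire_saturated bK.
  exact: compact_saturated_zero_set (compact_sublevel r0) cg hg.
have rd (l j : nat) : 0 <= j%:R / 2 ^+ l :> R by rewrite divr_ge0// pow2_ge0.
pose r l j : {r : R | 0 <= r} := exist (fun r : R => 0 <= r) _ (rd l j).
(* With [r = j / 2 ^ l], the factor [h n] vanishes where [rho <= r] and the cap [r] is below [rho]
   elsewhere, so each [phi p] stays below [rho]. A large [k] makes the cap effective at any point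
   with [h n > 0]. *)
pose phi (p : nat * nat * nat * nat) x := let: (l, j, n, k) := p in
  Num.min (sval (r l j)) (k%:R * h (r l j) n x).
have cphi p : Cb (phi p).
  case: p => [[[l j] n] k]; have [ch h0 hK _] := hh (r l j); split.
    apply: min_fun_continuous; first exact: cst_continuous.
    by move=> x; apply: cvgM; [exact: cvg_cst|exact: ch].
  exists (sval (r l j)) => x; rewrite /phi ger0_norm; first by rewrite ge_min lexx.
  by rewrite le_min (rd l j) mulr_ge0.
have phi_ge0 p x : 0 <= phi p x.
  by case: p => [[[l j] n] k]; have [ch h0 hK _] := hh (r l j);
    rewrite /phi le_min (rd l j) mulr_ge0.
have phi_le p x : phi p x <= rho x.
  case: p => [[[l j] n] k]; have [ch h0 hK _] := hh (r l j); rewrite /phi.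
  have [/hK->|xr] := leP (rho x) (sval (r l j)).
    by rewrite mulr0 ge_min (ltW (rho_gt0 x)) orbT.
  by rewrite ge_min (ltW xr).
have phi_gt x c : 0 <= c -> c < rho x -> exists p, c < phi p x.
  move=> c0 cx; have [q [[l [j ->]] cq qx]] := dyadic_dense c0 cx.
  have [ch h0 hK hn] := hh (r l j).
  have [|n hnx] := hn x; first by apply/negP; rewrite -ltNge.
  exists (l, j, n, (Num.trunc (j%:R / 2 ^+ l / h (r l j) n x)).+1).
  rewrite /phi lt_min cq /= (lt_trans cq)// -ltr_pdivrMr//.
  exact: truncnS_gt.
pose psi k := if unpickle k is Some p then phi p else fun=> 0.
have psi_ge0 k x : 0 <= psi k x by rewrite /psi; case: unpickle.
have psi_le k x : psi k x <= rho x by rewrite /psi; case: unpickle => // *; exact: ltW.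
have cpsi k : Cb (psi k) by rewrite /psi; case: unpickle => *; [exact: cphi|exact: Cb_cst].
(* Running maxima of the enumerated family turn its supremum into an increasing limit. *)
pose f := fix f k x := if k is j.+1 then Num.max (f j x) (psi j x) else 0.
have f_le k x : 0 <= f k x <= rho x.
  elim: k => [|k /andP[IH1 IH2]] /=; first by rewrite lexx ltW.
  by rewrite le_max IH1 ge_max IH2 psi_le.
have fS k x : f k x <= f k.+1 x by rewrite /= le_max lexx.
exists f; split => //.
  by elim=> [|k IH]; [exact: Cb_cst|exact: Cb_max].
move=> x; apply/cvgrPdist_lt => e e0.
have [p hp] : exists p, rho x - e < phi p x.
  have [|] := leP 0 (rho x - e).
    by move=> /phi_gt; apply; rewrite ltrBlDr ltrDl.
  by move=> h0; exists (0, 0, 0, 0)%N; exact: lt_le_trans h0 (phi_ge0 _ _).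
have fmono m n : (m <= n)%N -> f m x <= f n x.
  elim: n => [|n IH]; first by rewrite leqn0 => /eqP ->.
  by rewrite leq_eqVlt => /orP[/eqP -> //|/IH /le_trans]; apply.
exists (pickle p).+1 => // n /= pn.
have h1 : phi p x <= f n x.
  by apply: le_trans (fmono _ _ pn); rewrite /= le_max /psi pickleK lexx orbT.
have /andP[_ h2] := f_le n x.
by rewrite ger0_norm ?subr_ge0//; lra.
Qed.

End weighted.

(** * The semigroup and its resolvent *)

Definition halfline (R : realType) : set (measurableTypeR R) := [set s : R | 0 <= s].

Lemma measurable_halfline (R : realType) : measurable (@halfline R).
Proof.
rewrite (_ : @halfline R = `[0 : R, +oo[%classic); first exact: measurable_itv.
by apply/seteqP; split => x /=; rewrite /halfline/= in_itv/= andbT.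
Qed.

Arguments measurable_halfline R : clear implicits.

Lemma measurable_expR_lin (R : realType) (c : R) (D : set (measurableTypeR R)) :
  measurable_fun D (fun s : measurableTypeR R => expR (- (c * s))).
Proof.
by apply: measurable_funTS; apply: measurableT_comp => //; apply: measurableT_comp => //.
Qed.

Lemma integral_expR_halfline (R : realType) (c : R) : 0 < c ->
  (\int[lebesgue_measure]_(s in @halfline R) (expR (- (c * s)))%:E = c^-1%:E)%E.
Proof.
move=> c0; have := integral_exponential_pdf c0.
rewrite /exponential_pdf.
rewrite (_ : (fun x => _) = (fun s => (c%:E * (expR (- (c * s)))%:E)%E) \_ (@halfline R)).
  rewrite -integral_mkcond ge0_integralZl//.
  - by move=> h; rewrite -[LHS]mul1e -(mulVf (lt0r_neq0 c0)) EFinM -muleA h mule1.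
  - exact: measurable_halfline.
  - by apply/measurable_EFinP; exact: measurable_expR_lin.
  - by rewrite lee_fin ltW.
apply/funext => x; rewrite !patchE.
have -> : (x \in `[0, +oo[%classic) = (x \in @halfline R).
  by apply/idP/idP; rewrite !inE /halfline /= in_itv/= andbT.
by case: ifPn => // _; rewrite mulNr -EFinM.
Qed.

Lemma lebesgue_measure_translation (R : realType) (h : R) (A : set R) : measurable A ->
  pushforward lebesgue_measure ((fun x => x + h) : _ -> measurableTypeR R) A =
  lebesgue_measure A :> \bar R.
Proof.
move=> mA; have mh : measurable_fun setT ((fun x => x + h) : R -> measurableTypeR R).
  exact: measurable_funD.
apply/esym/lebesgue_measure_unique => //= _ [[a b]] _ <-.
rewrite /pushforward (_ : _ @^-1` _ = `]a - h, b - h]%classic).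
  rewrite !lebesgue_measure_itv/= !lte_fin ltrD2r; case: ifP => // _.
  by rewrite -!EFinB; congr EFin; ring.
by apply/seteqP; split => x /=; rewrite !in_itv/= ltrBlDr lerBrDr.
Qed.

(** After the translation only the part over [[h, +oo[] remains. This loss is the source of the
    supermartingale inequality for resolvents. *)
Lemma ge0_integral_translation_le (R : realType) (h : R) (phi : R -> \bar R) : 0 <= h ->
  measurable_fun setT phi -> (forall x, 0 <= phi x)%E ->
  (\int[lebesgue_measure]_(s in @halfline R) phi (s + h)%R <=
   \int[lebesgue_measure]_(s in @halfline R) phi s)%E.
Proof.
move=> h0 mphi phi0.
have mh : measurable_fun setT ((fun x => x + h) : measurableTypeR R -> measurableTypeR R).
  exact: measurable_funD.
have mphi' : measurable_fun (`[h, +oo[%classic : set (measurableTypeR R)) phi.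
  exact: measurable_funS mphi.
have -> : (\int[lebesgue_measure]_(s in @halfline R) phi (s + h)%R =
    \int[lebesgue_measure]_(v in `[h, +oo[) phi v)%E.
  transitivity (\int[pushforward lebesgue_measure
      ((fun x : R => (x + h)%R) : measurableTypeR R -> measurableTypeR R)]_(v in `[h, +oo[) phi v)%E.
    rewrite ge0_integral_pushforward//; congr (integral _ _ _).
    by apply/seteqP; split => x /=; rewrite /halfline /= in_itv/= andbT lerDr.
  by apply: eq_measure_integral => A mA _; exact: lebesgue_measure_translation.
apply: ge0_subset_integral => //.
- exact: measurable_halfline.
- exact: measurable_funS mphi.
- by move=> x /=; rewrite in_itv/= andbT /halfline /=; exact: le_trans.
Qed.

Section semigroup.
Context (R : realType) (E : ptopologicalType) (rho : E -> R).
Variables (P : R -> (E -> R) -> (E -> R)) (M omega : R).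
Hypothesis ws : weighted_space rho.
Hypothesis gfs : gen_feller_semigroup rho P.
Hypothesis P1 : forall t, 0 <= t -> P t (fun _ => 1) = (fun _ => 1).
Hypothesis M1 : 1 <= M.
Hypothesis gb : growth_bound rho P M omega.
Implicit Types f g : E -> R.

Let rho_gt0 : forall x, 0 < rho x := ws.2.2.1.

Lemma P_Brho t f : 0 <= t -> Brho rho f -> Brho rho (P t f).
Proof. by move=> t0; exact: (gfs.1 t t0). Qed.

Lemma P_lin t (a b : R) f g : 0 <= t -> Brho rho f -> Brho rho g ->
  P t (fun x => a * f x + b * g x) = (fun x => a * P t f x + b * P t g x).
Proof. by move=> t0; exact: (gfs.2.1 t t0). Qed.

Lemma P_0 f : Brho rho f -> P 0 f = f.
Proof. exact: gfs.2.2.2.1. Qed.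

Lemma P_add u h f : 0 <= u -> 0 <= h -> Brho rho f -> P (u + h) f = P h (P u f).
Proof. by move=> u0 h0; exact: (gfs.2.2.2.2.1 h u h0 u0). Qed.

Lemma P_ge0 t f : 0 <= t -> Brho rho f -> (forall x, 0 <= f x) -> forall x, 0 <= P t f x.
Proof. by move=> t0; exact: (gfs.2.2.2.2.2.2.2 t t0). Qed.

Lemma P_right_cont f (u : R) x : 0 <= u -> Brho rho f ->
  P v f x @[v --> u^'+] --> P u f x.
Proof.
move=> u0 bf; have := gfs.2.2.2.2.2.1 (P u f) (P_Brho u0 bf) x.
move=> /cvgrPdist_lt h; apply/cvgrPdist_lt => e /h[d /= d0 hd].
exists d => //= v uv ltuv.
have := hd (v - u); rewrite -P_add ?subr_ge0 ?(ltW ltuv)// subrKC; apply.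
  by rewrite /= sub0r opprB.
by rewrite subr_gt0.
Qed.

Lemma P_dyadic_cvg f (u : R) x : 0 <= u -> Brho rho f ->
  P (dyadic_above u n) f x @[n --> \oo] --> P u f x.
Proof.
move=> u0 bf; have h := P_right_cont (x := x) u0 bf.
apply: (cvg_comp _ _ _ h) => A [d /= d0 hd].
have /cvgrPdist_lt /(_ d d0) := cvg_dyadic_above u0.
apply: filterS => n hn; apply: hd => //.
exact: dyadic_above_gt.
Qed.

Lemma P_mono t f g : 0 <= t -> Brho rho f -> Brho rho g ->
  (forall x, f x <= g x) -> forall x, P t f x <= P t g x.
Proof.
move=> t0 bf bg fg x; have := @P_ge0 t (fun x => 1 * g x + (-1) * f x) t0.
rewrite P_lin// => /(_ (Brho_lin ws _ _ bg bf)) h.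
have := h _ x; rewrite mul1r mulN1r subr_ge0; apply => y.
by rewrite mul1r mulN1r subr_ge0.
Qed.

Lemma P_cst t (c : R) : 0 <= t -> P t (fun=> c) = (fun=> c).
Proof.
move=> t0; have b1 : Brho rho (fun=> 1) by apply: Cb_Brho => //; exact: Cb_cst.
have := @P_lin t c 0 _ _ t0 b1 b1; rewrite P1//.
have -> : (fun _ : E => c * 1 + 0 * 1) = (fun=> c) by apply/funext => y; ring.
by [].
Qed.

Lemma P_bounded t f (C : R) : 0 <= t -> Brho rho f -> (forall x, `|f x| <= C) ->
  forall x, `|P t f x| <= C.
Proof.
move=> t0 bf hC x; have bc (c : R) : Brho rho (fun=> c).
  by apply: Cb_Brho => //; exact: Cb_cst.
rewrite ler_norml; apply/andP; split.
  have := @P_mono t (fun=> - C) f t0 (bc _) bf; rewrite P_cst//; apply => y.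
  by have := hC y; rewrite ler_norml => /andP[].
have := @P_mono t f (fun=> C) t0 bf (bc _); rewrite P_cst//; apply => y.
by have := hC y; rewrite ler_norml => /andP[].
Qed.

Lemma P_growth t f (C : R) : 0 <= t -> Brho rho f -> 0 <= C ->
  (forall x, `|f x| <= C * rho x) ->
  forall x, `|P t f x| <= M * expR (omega * t) * C * rho x.
Proof.
move=> t0 bf C0 hC; apply/(rho_norm_leP ws); apply: (le_trans (gb t0 bf)).
rewrite [leRHS]EFinM; apply: lee_wpmul2l; last exact/(rho_norm_leP ws).
by rewrite lee_fin mulr_ge0 ?expR_ge0// (le_trans ler01).
Qed.

(** Constants are preserved and dominated by a multiple of [rho], so the semigroup cannot contract
    to 0 in the weighted norm. *)
Lemma omega_ge0 : 0 <= omega.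
Proof.
rewrite leNgt; apply/negP => om0.
have b1 : Brho rho (fun=> 1) by apply: Cb_Brho => //; exact: Cb_cst.
have [c c0 hc] := weight_lower_bound ws.
have hC x : `|1 : R| <= c^-1 * rho x by rewrite normr1 ler_pdivlMl// mulr1.
pose K := M * c^-1 * rho point.
have K0 : 0 < K by rewrite !mulr_gt0 ?invr_gt0// (lt_le_trans ltr01).
(* At this time the growth bound for the constant 1 reads [1 <= K / expR K], against
   [1 + K <= expR K]. *)
have t0 : 0 <= K / - omega by rewrite divr_ge0 ?oppr_ge0 ?(ltW K0)// ltW.
have := P_growth t0 b1 _ hC point; rewrite P1// normr1 invr_ge0 (ltW c0) => /(_ isT).
have -> : omega * (K / - omega) = - K by field; rewrite lt_eqF.
have -> : M * expR (- K) / c * rho point = K / expR K by rewrite /K expRN; ring.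
rewrite leNgt => /negP; apply; rewrite ltr_pdivrMr ?expR_gt0// mul1r.
by rewrite (lt_le_trans _ (expR_ge1Dx _))// ltrDr.
Qed.

Lemma dyadic_above_max0 (u : R) n : dyadic_above u n = dyadic_above (Num.max u 0) n.
Proof.
have [u0|//] := leP u 0; rewrite /dyadic_above mul0r truncn0.
have -> // : Num.trunc (u * 2 ^+ n) = 0%N.
apply/truncn0Pn; rewrite -ltNge (@le_lt_trans _ _ 0)//.
by rewrite pmulr_lle0// pow2_gt0.
Qed.

(** By right continuity in time the map is a pointwise limit of maps that are step functions of
    time, each with Borel values in space. The maximum with 0 extends it to negative times. *)
Lemma P_jointly_measurable f : Brho rho f ->
  measurable_fun setT (fun ux : measurableTypeR R * borelE E => P (Num.max ux.1 0) f ux.2).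
Proof.
move=> bf.
apply: (@measurable_fun_cvg _ _ R setT (fun n (ux : measurableTypeR R * borelE E) => P (dyadic_above ux.1 n) f ux.2)); last first.
  move=> [u x] _ /=; under eq_fun do rewrite dyadic_above_max0.
  by apply: P_dyadic_cvg => //; rewrite le_max lexx orbT.
move=> n _ Y mY; rewrite setTI.
(* On [A k] the time [dyadic_above u n] equals [q k], so the preimage is a countable union of
   rectangles. *)
pose A k : set (measurableTypeR R) := [set u : R | Num.trunc (u * 2 ^+ n) = k].
pose q k : R := k.+1%:R / 2 ^+ n.
have mle k : measurable ([set u : R | (Num.trunc (u * 2 ^+ n) <= k)%N] : set (measurableTypeR R)).
  rewrite (_ : [set u | _] = `]-oo, q k[%classic); first exact: measurable_itv.
  apply/seteqP; split => u /=; rewrite in_itv/= truncn_le_nat ltr_pdivlMr ?pow2_gt0//.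
have mA k : measurable (A k).
  case: k => [|k].
    by rewrite (_ : A 0%N = [set u : R | (Num.trunc (u * 2 ^+ n) <= 0)%N])//;
      apply/seteqP; split => u /=; rewrite /A /= leqn0 => /eqP.
  rewrite (_ : A k.+1 = [set u : R | (Num.trunc (u * 2 ^+ n) <= k.+1)%N] `\`
    [set u : R | (Num.trunc (u * 2 ^+ n) <= k)%N]); first exact: measurableD.
  apply/seteqP; split => u /=; rewrite /A /=; first by move=> ->; rewrite leqnn ltnn.
  by move=> [h1 /negP]; rewrite -ltnNge => h2; apply/eqP; rewrite eqn_leq h1.
have mP k : measurable ((P (q k) f : borelE E -> R) @^-1` Y).
  have b : Brho rho (P (q k) f) by apply: P_Brho => //; rewrite divr_ge0// pow2_ge0.
  by rewrite -[X in measurable X]setTI; exact: (Brho_borel_measurable ws b).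
rewrite (_ : _ @^-1` _ = \bigcup_k (A k `*` ((P (q k) f : borelE E -> R) @^-1` Y))).
  by apply: bigcupT_measurable => k; exact: measurableX.
apply/seteqP; split => [[u x] /= Yu|[u x] [k _ [/= <- //]]].
by exists (Num.trunc (u * 2 ^+ n)).
Qed.

Lemma P_time_measurable f x : Brho rho f -> 
  measurable_fun (@halfline R) (fun s : measurableTypeR R => P s f x).
Proof.
move=> bf; apply: (eq_measurable_fun (fun s : measurableTypeR R => P (Num.max s 0) f x)).
  by move=> s; rewrite inE /halfline /= => s0; rewrite max_l.
apply: measurable_funTS.
exact: (@measurable_fun_pair1 _ _ _ (measurableTypeR R) (borelE E) _ _ x (P_jointly_measurable bf)).
Qed.

(** * The resolvent at a fixed parameter above the growth rate *)

Variable beta : R.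
Hypothesis beta_gt : omega < beta.

Lemma resolvent_integrand_bound f (C : R) x s : Brho rho f -> 0 <= C ->
  (forall x, `|f x| <= C * rho x) -> 0 <= s ->
  `|expR (- (beta * s)) * P s f x| <= (M * C * rho x) * expR (- ((beta - omega) * s)).
Proof.
move=> bf C0 hC s0; rewrite normrM ger0_norm ?expR_ge0//.
apply: (@le_trans _ _ (expR (- (beta * s)) * (M * expR (omega * s) * C * rho x))).
  by apply: ler_wpM2l; [exact: expR_ge0|exact: P_growth].
have -> : - ((beta - omega) * s) = - (beta * s) + omega * s by ring.
by rewrite expRD; rewrite le_eqVlt; apply/orP; left; apply/eqP; ring.
Qed.

Lemma integrable_expR_halfline (c : R) k : 0 < c ->
  lebesgue_measure.-integrable (@halfline R) (fun s : measurableTypeR R => (k * expR (- (c * s)))%:E).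
Proof.
move=> c0; under eq_fun do rewrite EFinM.
apply: integrableZl; first exact: measurable_halfline.
apply/integrableP; split.
  by apply/measurable_EFinP; exact: measurable_expR_lin.
under eq_integral do rewrite gee0_abs ?lee_fin ?expR_ge0//.
by rewrite integral_expR_halfline// ltry.
Qed.

Lemma resolvent_integrable f x : Brho rho f ->
  lebesgue_measure.-integrable (@halfline R) (fun s : measurableTypeR R => (expR (- (beta * s)) * P s f x)%:E).
Proof.
move=> bf; have [C [C0 _ hC]] := Brho_norm_fin ws bf.
apply: (le_integrable (measurable_halfline R) _ _
  (@integrable_expR_halfline (beta - omega) (M * C * rho x) _)).
- apply/measurable_EFinP; apply: measurable_funM; first exact: measurable_expR_lin.
  exact: P_time_measurable.
- move=> s s0 /=; rewrite lee_fin (le_trans (resolvent_integrand_bound _ bf C0 hC s0))//.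
  exact: ler_norm.
- by rewrite subr_gt0.
Qed.

Lemma resolventE f x : Brho rho f ->
  ((resolvent P beta f x)%:E =
   \int[lebesgue_measure]_(s in @halfline R) (expR (- (beta * s)) * P s f x)%:E)%E.
Proof.
move=> bf; rewrite /resolvent fineK//; apply: integrable_fin_num => //.
  exact: measurable_halfline.
exact: resolvent_integrable.
Qed.

Lemma resolvent_le f x (k c : R) : Brho rho f -> 0 < c ->
  (forall s, 0 <= s -> `|expR (- (beta * s)) * P s f x| <= k * expR (- (c * s))) ->
  `|resolvent P beta f x| <= k / c.
Proof.
move=> bf c0 h; rewrite -lee_fin -[X in (X <= _)%E]abse_EFin resolventE//.
apply: (le_trans (le_abse_integral _ (measurable_halfline R) _)).
  exact: measurable_int (resolvent_integrable x bf).
have k0 : 0 <= k.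
  have := h 0 (lexx _); rewrite !mulr0 oppr0 expR0 mulr1; exact: le_trans.
rewrite EFinM -integral_expR_halfline// -ge0_integralZl//; first last.
- by apply/measurable_EFinP; exact: measurable_expR_lin.
- exact: measurable_halfline.
apply: ge0_le_integral => //.
- exact: measurable_halfline.
- apply: measurableT_comp => //; exact: measurable_int (resolvent_integrable x bf).
- by apply: measurable_funeM; apply/measurable_EFinP; exact: measurable_expR_lin.
Qed.

Lemma resolvent_lin (a b : R) f g x : Brho rho f -> Brho rho g ->
  resolvent P beta (fun x => a * f x + b * g x) x =
  a * resolvent P beta f x + b * resolvent P beta g x.
Proof.
move=> bf bg; apply: EFin_inj; rewrite EFinD !EFinM !resolventE//; last exact: Brho_lin.
have mh := measurable_halfline R.
rewrite -(integralZl mh (resolvent_integrable x bf) a).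
rewrite -(integralZl mh (resolvent_integrable x bg) b).
rewrite -integralD//; first last.
- by apply: integrableZl; [exact: measurable_halfline|exact: resolvent_integrable].
- by apply: integrableZl; [exact: measurable_halfline|exact: resolvent_integrable].
apply: eq_integral => s; rewrite inE => s0.
by rewrite P_lin// -!EFinM -EFinD; congr EFin; ring.
Qed.

Lemma resolvent_ge0 f x : Brho rho f -> (forall x, 0 <= f x) -> 0 <= resolvent P beta f x.
Proof.
move=> bf f0; rewrite -lee_fin resolventE//; apply: integral_ge0 => s s0.
by rewrite lee_fin mulr_ge0 ?expR_ge0//; exact: P_ge0.
Qed.

Lemma resolvent_bound f (C : R) x : Brho rho f -> 0 <= C ->
  (forall x, `|f x| <= C * rho x) ->
  `|resolvent P beta f x| <= M * C * rho x / (beta - omega).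
Proof.
move=> bf C0 hC; apply: resolvent_le => //; first by rewrite subr_gt0.
by move=> s s0; exact: resolvent_integrand_bound.
Qed.

Lemma resolvent_bounded f (C : R) x : Brho rho f -> (forall x, `|f x| <= C) ->
  `|resolvent P beta f x| <= C / beta.
Proof.
move=> bf hC; apply: resolvent_le => //; first exact: le_lt_trans omega_ge0 beta_gt.
move=> s s0; rewrite normrM ger0_norm ?expR_ge0// mulrC.
by apply: ler_wpM2r; [exact: expR_ge0|exact: P_bounded].
Qed.

(* P u f is determined by the countably many P q f with q dyadic, so points of
   the sublevel set may be approached by sequences, along which dominated
   convergence applies. *)
Lemma resolvent_within_cont f (r : R) : 0 <= r -> Brho rho f ->
  within_cont [set x | rho x <= r] (resolvent P beta f).
Proof.
move=> r0 bf x Kx; set K := [set x | rho x <= r] in Kx *.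
have cK : compact K by exact: ws.2.2.2.
pose q (j : nat) : R := if unpickle j is Some (n, i) then i%:R / 2 ^+ n else 0.
have q0 j : 0 <= q j.
  by rewrite /q; case: unpickle => // -[n i]; rewrite divr_ge0// pow2_ge0.
have qd d : dyadic d -> exists j, d = q j.
  by move=> [n [i ->]]; exists (pickle (n, i)); rewrite /q pickleK.
have cP u : 0 <= u -> within_cont K (P u f).
  by move=> u0; apply: (Brho_within_cont ws) => //; exact: P_Brho.
apply/cvgrPdist_lt => e e0; apply: contrapT => ncvg.
have near_q n m : \forall z \near within K (nbhs x),
    forall j, (j < m)%N -> `|P (q j) f x - P (q j) f z| < n.+1%:R^-1.
  elim: m => [|m IH]; first by apply: nearW.
  have := cP _ (q0 m) x Kx => /cvgrPdist_lt /(_ n.+1%:R^-1).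
  rewrite invr_gt0 ltr0Sn => /(_ isT) h; apply: filterS2 IH h => z h1 h2 j.
  by rewrite ltnS leq_eqVlt => /orP[/eqP ->|/h1].
(* Failure of convergence is turned into a sequence in [K] that matches ever more of the values
   [P (q j) f x] while its resolvent values stay at distance [e]. *)
have /choice[y hy] : forall n, exists z, [/\ K z,
    forall j, (j < n)%N -> `|P (q j) f x - P (q j) f z| < n.+1%:R^-1 &
    e <= `|resolvent P beta f x - resolvent P beta f z|].
  move=> n; apply: contrapT => nz; apply: ncvg.
  have := near_q n n; apply: filterS2 (withinT _ _) => z Kz hz.
  by rewrite ltNge; apply/negP => he; apply: nz; exists z.
have yK n : K (y n) by have [] := hy n.
(* The sequence [y] itself need not converge to [x]. A cluster point shares all dyadic values with
   [x], hence, by right continuity in time, the value of [P u f]. *)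
have cvgP u : 0 <= u -> P u f (y n) @[n --> \oo] --> P u f x.
  move=> u0; apply: (@cvg_cluster_separated nat E R nat (fun=> R : topologicalType)
    \oo y K x (fun j => P (q j) f) (P u f)) => //.
  - by exists 0%N => // n _; exact: yK.
  - by move=> j; exact: cP.
  - exact: cP.
  - move=> j; apply/cvgrPdist_lt => d d0.
    near=> n; have [_ /(_ j) + _] := hy n.
    have -> : (j < n)%N by near: n; exists j.+1.
    move=> /(_ isT) /lt_trans; apply.
    rewrite invf_plt ?posrE//.
    apply: (@lt_trans _ _ n%:R); last by rewrite ltr_nat.
    by near: n; exact: nbhs_infty_gtr.
  - move=> z Kz hz.
    have h1 := P_dyadic_cvg (x := z) u0 bf; have h2 := P_dyadic_cvg (x := x) u0 bf.
    have eq12 : (fun n => P (dyadic_above u n) f z) = (fun n => P (dyadic_above u n) f x).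
      apply/funext => n; have [j ->] := qd _ (dyadic_dyadic_above u n); exact: hz.
    by rewrite eq12 in h1; exact: (cvg_unique _ h1 h2).
have [C [C0 _ hC]] := Brho_norm_fin ws bf.
have mh := measurable_halfline R.
have [||| _ _ dct] := @dominated_convergence _ _ _ lebesgue_measure (@halfline R) mh
  (fun n s => (expR (- (beta * s)) * P s f (y n))%:E)
  (fun s => (expR (- (beta * s)) * P s f x)%:E)
  (fun s => ((M * C * r) * expR (- ((beta - omega) * s)))%:E)
  (fun n => measurable_int _ (resolvent_integrable (y n) bf))
  (measurable_int _ (resolvent_integrable x bf)).
- apply: aeW => s s0; apply: cvg_EFin; first by apply: nearW.
  by apply: cvgM; [exact: cvg_cst|exact: cvgP].
- by apply: integrable_expR_halfline; rewrite subr_gt0.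
- apply: aeW => s n s0; rewrite abse_EFin lee_fin.
  rewrite (le_trans (resolvent_integrand_bound _ bf C0 hC s0))//.
  apply: ler_wpM2r; first exact: expR_ge0.
  by apply: ler_wpM2l; [rewrite mulr_ge0// (le_trans ler01)|exact: yK].
have : (resolvent P beta f (y n))%:E @[n --> \oo] --> (resolvent P beta f x)%:E.
  by rewrite resolventE//; under eq_fun do rewrite resolventE//.
move=> /fine_cvg /cvgrPdist_lt /(_ e e0) [n _ /(_ n (leqnn n)) /=].
by have [_ _] := hy n; rewrite leNgt => /negP.
Unshelve. all: by end_near. Qed.

Lemma resolvent_Brho f : Brho rho f -> Brho rho (resolvent P beta f).
Proof.
move=> bf; apply: (Brho_closed ws) => e e0.
have bo : 0 < beta - omega by rewrite subr_gt0.
have M0 : 0 < M := lt_le_trans ltr01 M1.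
(* Inverse of the bound [M / (beta - omega)] for the resolvent in the weighted norm, times [e]. *)
have d0 : 0 < e * (beta - omega) / M by rewrite divr_gt0// mulr_gt0.
have [g [cg hg]] := (BrhoP ws f).1 bf _ d0.
have bg : Brho rho g := Cb_Brho ws cg.
exists (resolvent P beta g); split.
  apply: (bounded_within_cont_Brho ws).
    by have [_ [C hC]] := cg; exists (C / beta) => x; exact: resolvent_bounded.
  by move=> r r0; exact: resolvent_within_cont.
move=> x; have bfg := Brho_lin ws 1 (-1) bf bg.
have := @resolvent_bound (fun x => 1 * f x + -1 * g x) _ x bfg (ltW d0).
rewrite resolvent_lin// mul1r mulN1r => /(_ _)/le_trans; apply.
  by move=> z; rewrite mul1r mulN1r.
rewrite le_eqVlt; apply/orP; left; apply/eqP; field.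
by rewrite !gt_eqF.
Qed.

End semigroup.

(** A quantitative uniqueness argument for Laplace transforms at integers. If
    [psi s = P s f x - P s f y] were at least [c / 2] on [[0, d]], this would contribute about
    [c / (2 * beta)] to the transform, whereas times beyond [d] contribute only a multiple of
    [expR (- (n * d))] for [beta = b0 + n]. A vanishing transform would make an exponential in [n]
    grow at most linearly. *)
Lemma resolvent_separates (R : realType) (E : ptopologicalType) (rho : E -> R)
    (P : R -> (E -> R) -> (E -> R)) (M omega : R) (f : E -> R) (x y : E) :
  weighted_space rho -> gen_feller_semigroup rho P ->
  (forall t, 0 <= t -> P t (fun _ => 1) = (fun _ => 1)) -> 1 <= M ->
  growth_bound rho P M omega -> Brho rho f ->
  (forall beta : int, omega < beta%:~R ->
    resolvent P beta%:~R f x = resolvent P beta%:~R f y) -> f x = f y.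
Proof.
move=> ws gfs P1 M1 gb bf.
wlog lefxy : x y / f y <= f x => [wlog_|h].
  by have [/wlog_ //|/ltW h1 h2] := leP (f y) (f x); apply/esym/wlog_ => // b /h2.
apply/eqP; rewrite eq_le lefxy andbT leNgt; apply/negP => fxy.
pose c := f x - f y; have c0 : 0 < c by rewrite subr_gt0.
pose psi s := P s f x - P s f y.
have [d d0 hd] : exists2 d, 0 < d & forall s, 0 <= s <= d -> c / 2 <= psi s.
  have cx := gfs.2.2.2.2.2.1 f bf x; have cy := gfs.2.2.2.2.2.1 f bf y.
  have : P t f x - P t f y @[t --> 0^'+] --> f x - f y by exact: cvgB.
  move=> /cvgrPdist_lt /(_ (c / 2)); rewrite divr_gt0// => /(_ isT).
  move=> [d /= d0 hd]; exists (d / 2); first by rewrite divr_gt0.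
  move=> s /andP[]; rewrite le_eqVlt => /orP[/eqP <- _|s0 sd].
    by rewrite /psi (P_0 gfs bf) -/c ler_pdivrMr// ler_peMr ?(ltW c0)// ler1n.
  have := hd s; rewrite /= sub0r normrN gtr0_norm// -/(psi s) -/c.
  have -> : s < d by rewrite (le_lt_trans sd)// ltr_pdivrMr// ltr_pMr// ltr1n.
  by move=> /(_ isT s0); rewrite ltr_norml => /andP[_]; lra.
have [C [C0 _ hC]] := Brho_norm_fin ws bf.
pose A := M * C * (rho x + rho y).
have rho_gt0 := ws.2.2.1.
have A0 : 0 <= A.
  by rewrite !mulr_ge0// ?(le_trans ler01 M1)// addr_ge0// ltW.
have hA s : 0 <= s -> `|psi s| <= A * expR (omega * s).
  move=> s0; rewrite (le_trans (ler_normB _ _))//.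
  have h1 := P_growth ws M1 gb s0 bf C0 hC x; have h2 := P_growth ws M1 gb s0 bf C0 hC y.
  apply: (le_trans (lerD h1 h2)).
  by rewrite le_eqVlt; apply/orP; left; apply/eqP; rewrite /A; ring.
have om0 := omega_ge0 ws P1 M1 gb.
pose b0 := (Num.trunc omega).+1.
have b0om : omega < b0%:R by exact: truncnS_gt.
pose B := (A + c / 2) / (b0%:R - omega) * (2 / c).
have key (n : nat) : expR (n%:R * d) <= B * (b0 + n)%:R.
  pose beta : R := (b0 + n)%:R.
  have beta0 : 0 < beta by rewrite ltr0n.
  have omb : omega < beta by rewrite (lt_le_trans b0om)// ler_nat leq_addr.
  have eqR : resolvent P beta f x = resolvent P beta f y.
    by have := h (b0 + n)%N; rewrite -pmulrn; apply.
  (* [A] pays for the possibly negative [psi] after time [d]; [c / 2] cancels the main term, so that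
     one lower bound holds at all times. *)
  pose D := (A + c / 2) * expR (- (n%:R * d)).
  have D0 : 0 <= D by rewrite mulr_ge0 ?expR_ge0// addr_ge0// divr_ge0// ltW.
  have lb s : 0 <= s -> c / 2 * expR (- (beta * s)) - D * expR (- ((b0%:R - omega) * s))
      <= expR (- (beta * s)) * P s f x - expR (- (beta * s)) * P s f y.
    move=> s0; rewrite -mulrBr -/(psi s).
    have e1 := expR_ge0 (- (beta * s)).
    have e2 := expR_ge0 (- ((b0%:R - omega) * s)).
    have [sd|ds] := leP s d.
      have := hd s; rewrite s0 sd => /(_ isT) hs.
      apply: (@le_trans _ _ (c / 2 * expR (- (beta * s)))).
        by rewrite gerBl mulr_ge0.
      by rewrite mulrC; apply: ler_wpM2l.
    have hps : - (A * expR (omega * s)) <= psi s.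
      by have := hA s s0; rewrite ler_norml => /andP[].
    have e3 : expR (- (beta * s)) * expR (omega * s) <=
        expR (- (n%:R * d)) * expR (- ((b0%:R - omega) * s)).
      rewrite -!expRD ler_expR /beta natrD.
      have : n%:R * d <= n%:R * s by apply: ler_wpM2l => //; exact: ltW.
      by lra.
    have e4 : expR (- (beta * s)) <= expR (- (beta * s)) * expR (omega * s).
      by rewrite ler_peMr// -expR0 ler_expR mulr_ge0.
    have e5 := le_trans e4 e3.
    set X := expR (- (n%:R * d)) * _ in e3 e5.
    have -> : D * expR (- ((b0%:R - omega) * s)) = (A + c / 2) * X by rewrite /D /X; ring.
    have h1 : A * (expR (- (beta * s)) * expR (omega * s)) <= A * X by apply: ler_wpM2l.
    have h2 : c / 2 * expR (- (beta * s)) <= c / 2 * X.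
      by apply: ler_wpM2l => //; rewrite divr_ge0// ltW.
    have h3 : expR (- (beta * s)) * - (A * expR (omega * s)) <= expR (- (beta * s)) * psi s.
      by apply: ler_wpM2l.
    have h4 : expR (- (beta * s)) * - (A * expR (omega * s)) =
      - (A * (expR (- (beta * s)) * expR (omega * s))) by ring.
    by rewrite h4 in h3; lra.
  have mh := measurable_halfline R.
  have bom : 0 < b0%:R - omega by rewrite subr_gt0.
  have i1 := integrable_expR_halfline (c / 2) beta0.
  have i2 := integrable_expR_halfline D bom.
  have i3 := resolvent_integrable ws gfs M1 gb omb x bf.
  have i4 := resolvent_integrable ws gfs M1 gb omb y bf.
  have : ((c / 2 / beta - D / (b0%:R - omega))%:E <=
      (resolvent P beta f x - resolvent P beta f y)%:E)%E.
    rewrite !EFinB !(resolventE ws gfs M1 gb omb)//.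
    have iE (k e : R) : 0 < e -> ((k / e)%:E =
        \int[lebesgue_measure]_(s in @halfline R) (k * expR (- (e * s)))%:E)%E.
      move=> e0; under eq_integral do rewrite EFinM.
      rewrite integralZl//; first by rewrite integral_expR_halfline.
      by have := integrable_expR_halfline 1 e0; under eq_fun do rewrite mul1r.
    rewrite (iE _ _ beta0) (iE _ _ bom) -!integralB//.
    apply: le_integral => //; [exact: integrableB|exact: integrableB|].
    by move=> s; rewrite inE => s0; rewrite -!EFinB lee_fin; exact: lb.
  rewrite eqR subrr lee_fin subr_le0 ler_pdivrMr// ler_pdivrMr// /D expRN.
  move=> hh; rewrite -[leLHS]mul1r -ler_pdivlMr ?expR_gt0//.
  rewrite -(ler_pM2l c0) mulr1 (le_trans hh)//.
  rewrite le_eqVlt; apply/orP; left; apply/eqP; rewrite /B -/beta; field.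
  by rewrite !gt_eqF// expR_gt0.
have B0 : 0 <= B.
  by rewrite !mulr_ge0 ?invr_ge0 ?subr_ge0 ?(ltW b0om) ?(ltW c0)// addr_ge0// divr_ge0// ltW.
(* Large enough that [(n * d / 2) ^ 2], a lower bound of [expR (n * d)], exceeds
   [B * (b0 + 1) * n]. *)
pose n := (Num.trunc (4 * B * (b0%:R + 1) / (d * d))).+1.
have nlt : 4 * B * (b0%:R + 1) / (d * d) < n%:R by exact: truncnS_gt.
have n1 : 1 <= n%:R :> R by rewrite ler1n.
have := key n; apply/negP; rewrite -ltNge.
have eh : expR (n%:R * d) = expR (n%:R * d / 2) * expR (n%:R * d / 2).
  by rewrite -expRD; congr expR; field.
have e1 := expR_ge1Dx (n%:R * d / 2).
have nd0 : 0 < n%:R * d by rewrite mulr_gt0// (lt_le_trans ltr01).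
have e2 : (n%:R * d / 2) * (n%:R * d / 2) <= expR (n%:R * d).
  rewrite eh; have e3 : n%:R * d / 2 <= expR (n%:R * d / 2) by lra.
  by apply: ler_pM => //; rewrite divr_ge0// ltW.
apply: lt_le_trans e2.
move: nlt; rewrite ltr_pdivrMr ?mulr_gt0// => nlt.
have h5 : B * (b0%:R + n%:R) <= B * ((b0%:R + 1) * n%:R).
  apply: ler_wpM2l => //; rewrite mulrDl mul1r lerD2r ler_peMr//.
rewrite natrD (le_lt_trans h5)//.
have h6 : 4 * B * (b0%:R + 1) * n%:R < n%:R * (d * d) * n%:R.
  by rewrite ltr_pM2r// (lt_le_trans ltr01).
by lra.
Qed.

(** * Resolvents along the process *)

Lemma ae_forall_countable (d : measure_display) (T : measurableType d) (R : realType)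
    (mu : {measure set T -> \bar R}) (J : countType) (Q : J -> T -> Prop) :
  (forall j, {ae mu, forall w, Q j w}) -> {ae mu, forall w j, Q j w}.
Proof.
move=> h; have := @ae_foralln _ _ _ mu (fun k w => if unpickle k is Some j then Q j w else True).
move=> H; have : {ae mu, forall w k, if unpickle k is Some j then Q j w else True}.
  by apply: H => k; case: (unpickle k) => [j|]; [exact: h|exact: aeW].
by apply: filterS => w hw j; have := hw (pickle j); rewrite pickleK.
Qed.

Lemma fubini_tonelli_restrict (d1 d2 : measure_display) (T1 : measurableType d1)
    (T2 : measurableType d2) (R : realType)
    (m1 : {sigma_finite_measure set T1 -> \bar R})
    (m2 : {sigma_finite_measure set T2 -> \bar R})
    (D1 : set T1) (D2 : set T2) (f : T1 * T2 -> \bar R) :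
  measurable D1 -> measurable D2 -> measurable_fun setT f -> (forall z, 0 <= f z)%E ->
  (\int[m1]_(x in D1) \int[m2]_(y in D2) f (x, y) =
   \int[m2]_(y in D2) \int[m1]_(x in D1) f (x, y))%E.
Proof.
move=> mD1 mD2 mf f0; pose g := f \_ (D1 `*` D2).
have mg : measurable_fun setT g.
  apply/(measurable_restrictT f (measurableX mD1 mD2)).
  exact: measurable_funS mf.
have g0 z : (0 <= g z)%E by rewrite /g patchE; case: ifP.
have := @fubini_tonelli _ _ _ _ _ m1 m2 g mg g0.
rewrite (_ : (fun x => _) = (fun x => \int[m2]_(y in D2) f (x, y))%E \_ D1); last first.
  apply/funext => x; rewrite patchE; case: ifPn => xD.
    rewrite [RHS]integral_mkcond; apply: eq_integral => y _; rewrite /g !patchE in_setX xD//=.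
  by rewrite integral0_eq// => y _; rewrite /g patchE in_setX (negbTE xD).
rewrite (_ : (fun y => _) = (fun y => \int[m1]_(x in D1) f (x, y))%E \_ D2); last first.
  apply/funext => y; rewrite patchE; case: ifPn => yD.
    by rewrite [RHS]integral_mkcond; apply: eq_integral => x _; rewrite /g !patchE in_setX yD andbT.
  by rewrite integral0_eq// => x _; rewrite /g patchE in_setX (negbTE yD) andbF.
by rewrite -!integral_mkcond.
Qed.

(** * Regulated paths and their right limits *)

Lemma dright_cvg_id (R : realType) (t : R) : id @ dright t --> t.
Proof.
move=> A [e /= e0 h]; apply/drightP; exists e => // q dq /andP[tq qt]; apply: h => /=.
by rewrite ltr0_norm ?subr_lt0// opprB ltrBlDl.
Qed.

Lemma dleft_cvg_id (R : realType) (t : R) : id @ dleft t --> t.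
Proof.
move=> A [e /= e0 h]; apply/dleftP; exists e => // q dq /andP[tq qt]; apply: h => /=.
by rewrite gtr0_norm ?subr_gt0// ltrBlDl -ltrBlDr.
Qed.

Lemma regulatedB (R : realType) (phi psi : R -> R) :
  regulated phi -> regulated psi -> regulated (fun q => phi q - psi q).
Proof.
move=> [r1 l1] [r2 l2]; split=> t t0.
  have [a ha] := r1 t t0; have [b hb] := r2 t t0; exists (a - b); exact: cvgB.
have [a ha] := l1 t t0; have [b hb] := l2 t t0; exists (a - b); exact: cvgB.
Qed.

Lemma regulatedM (R : realType) (c phi : R -> R) : continuous c ->
  regulated phi -> regulated (fun q => c q * phi q).
Proof.
move=> cc [r1 l1]; split=> t t0.
  have [a ha] := r1 t t0; exists (c t * a); apply: cvgM => //.
  exact: (cvg_comp _ _ (@dright_cvg_id R t) (cc t)).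
have [a ha] := l1 t t0; exists (c t * a); apply: cvgM => //.
exact: (cvg_comp _ _ (@dleft_cvg_id R t) (cc t)).
Qed.

(** The test concerns the whole path, not the time [t]: a bad path is replaced by a constant one, so
    every path of the version is càdlàg. *)
Definition rlim (R : realType) (V : ptopologicalType) (phi : R -> V) (t : R) : V :=
  if `[< regulated phi >] then lim (phi @ dright t) else point.

Lemma rlim_cvg (R : realType) (V : ptopologicalType) (phi : R -> V) (t : R) :
  regulated phi -> 0 <= t -> phi @ dright t --> rlim phi t.
Proof.
move=> rphi t0; rewrite /rlim asboolT//.
by have [l hl] := rphi.1 t t0; apply/cvg_ex; exists l.
Qed.

Lemma rlim_cadlag (R : realType) (V : ptopologicalType) (phi : R -> V) :
  @regular_space V -> cadlag (rlim phi).
Proof.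
move=> rV; have [rphi|nphi] := pselect (regulated phi).
  by apply: (cadlag_dright_limit rV rphi) => t t0; exact: rlim_cvg.
rewrite (_ : rlim phi = fun=> point); last by apply/funext => t; rewrite /rlim asboolF.
by split=> t t0; [exact: cvg_cst|exists point; exact: cvg_cst].
Qed.

Lemma rlim_cvg_seq (R : realType) (V : ptopologicalType) (phi : R -> V) (t : R) :
  regulated phi -> 0 <= t -> phi (dyadic_above t n) @[n --> \oo] --> rlim phi t.
Proof.
by move=> rphi t0; apply: (cvg_comp _ _ (cvg_dyadic_above_dright t0)); exact: rlim_cvg.
Qed.

Lemma real_regular (R : realType) : @regular_space R.
Proof. exact: uniform_regular. Qed.

Lemma Brho_maxr0 (R : realType) (E : ptopologicalType) (rho : E -> R) (f : E -> R) :
  weighted_space rho -> Brho rho f -> Brho rho (fun x => Num.max (f x) 0).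
Proof.
move=> ws; apply: (Brho_lipschitz ws (phi := fun y => Num.max y 0)) => x y.
have h1 := ler_norm (x - y); have h2 := ler_norm (y - x); rewrite distrC in h2.
by rewrite ler_norml; case: (leP x 0) => hx; case: (leP y 0) => hy; lra.
Qed.

Lemma clamp_lipschitz (R : realType) (c x y : R) :
  `|Num.min (Num.max (x - c) 0) 1 - Num.min (Num.max (y - c) 0) 1| <= `|x - y|.
Proof.
have h1 := ler_norm (x - y); have h2 := ler_norm (y - x); rewrite distrC in h2.
have h3 := normr_ge0 (x - y).
rewrite ler_norml; case: (leP (x - c) 0) => hx; case: (leP (y - c) 0) => hy;
  rewrite ?(min_l ler01); case: (leP (x - c) 1) => ?; case: (leP (y - c) 1) => ?; lra.
Qed.

Section process.
Context (d : measure_display) (T : measurableType d) (R : realType) (mu : probability T R).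
Context (E : ptopologicalType) (rho : E -> R).
Variables (P : R -> (E -> R) -> (E -> R)) (M omega : R).
Hypothesis ws : weighted_space rho.
Hypothesis gfs : gen_feller_semigroup rho P.
Hypothesis P1 : forall t, 0 <= t -> P t (fun _ => 1) = (fun _ => 1).
Hypothesis M1 : 1 <= M.
Hypothesis gb : growth_bound rho P M omega.
Variables (F : R -> set (set T)) (lamb : R -> T -> E).
Hypothesis fF : filtration F.
Hypothesis adapted : forall t, 0 <= t -> forall A : set (borelE E), measurable A ->
  F t (lamb t @^-1` A).
Hypothesis markov : forall s t, 0 <= s <= t -> forall f, Brho rho f ->
  mu.-integrable setT (fun w => (f (lamb t w))%:E) /\
  forall B, F s B -> (\int[mu]_(w in B) (f (lamb t w))%:E =
    \int[mu]_(w in B) (P (t - s) f (lamb s w))%:E)%E.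
Implicit Types f g : E -> R.

Let rho_gt0 : forall x, 0 < rho x := ws.2.2.1.

Lemma F_measurable t A : 0 <= t -> F t A -> measurable A.
Proof. by case: fF => _ + _ => /[apply]; exact. Qed.

Lemma lamb_measurable t : 0 <= t -> measurable_fun setT (lamb t : T -> borelE E).
Proof. by move=> t0 _ A mA; rewrite setTI; exact: F_measurable (adapted t0 mA). Qed.

Lemma borel_lamb_Gmeas t (f : borelE E -> R) : 0 <= t -> measurable_fun setT f ->
  Gmeas (F t) (fun w => f (lamb t w)).
Proof.
move=> t0 mf B mB; apply: (adapted t0 (A := f @^-1` B)).
by rewrite -[X in measurable X]setTI; exact: mf.
Qed.

Lemma borel_lamb_measurable t (f : borelE E -> R) : 0 <= t -> measurable_fun setT f ->
  measurable_fun setT (fun w => f (lamb t w)).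
Proof. by move=> t0 mf; exact: measurableT_comp mf (lamb_measurable t0). Qed.

Lemma Brho_lamb_integrable t f : 0 <= t -> Brho rho f ->
  mu.-integrable setT (fun w => (f (lamb t w))%:E).
Proof. by move=> t0 bf; have [] := @markov 0 t _ f bf; rewrite // lexx. Qed.

(** Tonelli's theorem; the joint measurability is that of [P_jointly_measurable], composed with the
    position at the fixed time [r]. *)
Lemma integral_resolvent_lamb beta g r A : omega < beta -> Brho rho g ->
  (forall x, 0 <= g x) -> 0 <= r -> measurable A ->
  (\int[mu]_(w in A) (resolvent P beta g (lamb r w))%:E =
   \int[lebesgue_measure]_(u in @halfline R)
     ((expR (- (beta * u)))%:E * \int[mu]_(w in A) (P u g (lamb r w))%:E))%E.
Proof.
move=> ob bg g0 r0 mA; have mh := measurable_halfline R.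
pose Phi (z : measurableTypeR R * borelE E) :=
  (expR (- (beta * z.1)) * P (Num.max z.1 0) g z.2)%:E.
have mPhi : measurable_fun setT Phi.
  apply/measurable_EFinP; apply: measurable_funM; last exact: (P_jointly_measurable ws gfs bg).
  exact: (measurableT_comp (@measurable_expR_lin R beta setT)
    (@measurable_fst _ _ (measurableTypeR R) (borelE E))).
have Phi0 z : (0 <= Phi z)%E.
  rewrite lee_fin mulr_ge0 ?expR_ge0//; apply: (P_ge0 gfs) => //.
  by rewrite le_max lexx orbT.
transitivity (\int[mu]_(w in A) \int[lebesgue_measure]_(u in @halfline R) Phi (u, lamb r w))%E.
  apply: eq_integral => w _; rewrite (resolventE ws gfs M1 gb ob)//.
  by apply: eq_integral => u; rewrite inE => u0; rewrite /Phi /= max_l.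
have mPt : measurable_fun setT (fun z : measurableTypeR R * T => Phi (z.1, lamb r z.2)).
  apply: (measurableT_comp mPhi); apply: measurable_fun_pair; first exact: measurable_fst.
  by apply: measurableT_comp; [exact: lamb_measurable|exact: measurable_snd].
rewrite -(@fubini_tonelli_restrict _ _ (measurableTypeR R) T R lebesgue_measure mu
  (@halfline R) A (fun z => Phi (z.1, lamb r z.2)) mh mA mPt (fun z => Phi0 _)) /=.
apply: eq_integral => u; rewrite inE => u0; have u00 : 0 <= u := u0.
rewrite -integralZl//; last first.
  by apply: integrableS (Brho_lamb_integrable r0 (P_Brho gfs u00 bg)).
by apply: eq_integral => w _; rewrite /Phi /= max_l.
Qed.

(** After the exchange of integrals the Markov property acts on [P u f] for each fixed [u], and the
    semigroup law lets [P u] and [P (t - s)] commute. *)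
Lemma integral_resolvent_markov beta f s t A : omega < beta -> Brho rho f ->
  (forall x, 0 <= f x) -> 0 <= s <= t -> F s A ->
  (\int[mu]_(w in A) (resolvent P beta f (lamb t w))%:E =
   \int[mu]_(w in A) (resolvent P beta (P (t - s) f) (lamb s w))%:E)%E.
Proof.
move=> ob bf f0 /andP[s0 st] FA.
have t0 : 0 <= t := le_trans s0 st.
have mA : measurable A := F_measurable s0 FA.
have h0 : 0 <= t - s by rewrite subr_ge0.
rewrite (integral_resolvent_lamb ob bf f0 t0 mA).
rewrite (integral_resolvent_lamb ob (P_Brho gfs h0 bf) (P_ge0 gfs h0 bf f0) s0 mA).
apply: eq_integral => u; rewrite inE => u0; have u00 : 0 <= u := u0.
have st' : 0 <= s <= t by rewrite s0.
have [_ ->//] := markov st' (P_Brho gfs u00 bf).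
by rewrite -(P_add gfs u00 h0 bf) -(P_add gfs h0 u00 bf) addrC.
Qed.

(** Resolvents of nonnegative functions are beta-excessive: shifting time by [h] in the Laplace
    integral drops the part over [[0, h)]. *)
Lemma resolvent_P_le beta f h x : omega < beta -> Brho rho f ->
  (forall x, 0 <= f x) -> 0 <= h ->
  resolvent P beta (P h f) x <= expR (beta * h) * resolvent P beta f x.
Proof.
move=> ob bf f0 h0; have mh := measurable_halfline R.
have bP := P_Brho gfs h0 bf.
pose phi (u : measurableTypeR R) := (expR (beta * h) * (expR (- (beta * u)) * P (Num.max u 0) f x))%:E.
have mphi : measurable_fun setT phi.
  apply/measurable_EFinP; apply: measurable_funM => //.
  apply: measurable_funM; first exact: measurable_expR_lin.
  exact: (@measurable_fun_pair1 _ _ _ (measurableTypeR R) (borelE E) _ _ x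
    (P_jointly_measurable ws gfs bf)).
have phi0 u : (0 <= phi u)%E.
  rewrite lee_fin !mulr_ge0 ?expR_ge0//; apply: (P_ge0 gfs) => //.
  by rewrite le_max lexx orbT.
rewrite -lee_fin EFinM !(resolventE ws gfs M1 gb ob)//.
rewrite -integralZl//; last exact: (resolvent_integrable ws gfs M1 gb ob).
apply: (@le_trans _ _ (\int[lebesgue_measure]_(u in @halfline R) phi (u + h)%R)%E).
  rewrite le_eqVlt; apply/orP; left; apply/eqP.
  apply: eq_integral => u; rewrite inE => u0; have u00 : 0 <= u := u0.
  rewrite /phi max_l ?addr_ge0// -(P_add gfs h0 u00 bf) (addrC u) mulrA -expRD.
  by congr (expR _ * _)%:E; ring.
apply: (le_trans (ge0_integral_translation_le h0 mphi phi0)).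
rewrite le_eqVlt; apply/orP; left; apply/eqP.
by apply: eq_integral => u; rewrite inE => u0; rewrite /phi max_l// EFinM.
Qed.

Lemma resolvent_supermartingale beta f : omega < beta -> Brho rho f -> (forall x, 0 <= f x) ->
  nonneg_supermartingale mu F (fun t w => expR (- (beta * t)) * resolvent P beta f (lamb t w)).
Proof.
move=> ob bf f0; have bR := resolvent_Brho ws gfs P1 M1 gb ob bf.
have R0 x : 0 <= resolvent P beta f x by exact: (resolvent_ge0 ws gfs M1 gb ob).
have iX t : 0 <= t -> mu.-integrable setT
    (EFin \o (fun w => expR (- (beta * t)) * resolvent P beta f (lamb t w))).
  move=> t0; rewrite /comp; under eq_fun do rewrite EFinM.
  by apply: integrableZl => //; exact: Brho_lamb_integrable.
split.
- by move=> t w t0; rewrite mulr_ge0 ?expR_ge0.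
- move=> t t0; apply: (@borel_lamb_Gmeas t (fun x => expR (- (beta * t)) * resolvent P beta f x)) => //.
  apply: measurable_funM; first exact: measurable_cst.
  exact: (Brho_borel_measurable ws bR).
- exact: iX.
- move=> s t /andP[s0 st] A FA; have t0 : 0 <= t := le_trans s0 st.
  have mA : measurable A := F_measurable s0 FA.
  have iR r : 0 <= r -> mu.-integrable A (fun w => (resolvent P beta f (lamb r w))%:E).
    by move=> r0; apply: integrableS (Brho_lamb_integrable r0 bR).
  under eq_integral do rewrite EFinM.
  under [leRHS]eq_integral do rewrite EFinM.
  rewrite !integralZl//; [|exact: iR|exact: iR].
  have st' : 0 <= s <= t by rewrite s0.
  rewrite (integral_resolvent_markov ob bf f0 st' FA).
  have h0 : 0 <= t - s by rewrite subr_ge0.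
  have bP := P_Brho gfs h0 bf.
  apply: (@le_trans _ _ ((expR (- (beta * t)))%:E *
    \int[mu]_(w in A) ((expR (beta * (t - s)))%:E * (resolvent P beta f (lamb s w))%:E))%E).
    apply: lee_wpmul2l; first by rewrite lee_fin expR_ge0.
    apply: le_integral => //.
    - apply: integrableS (Brho_lamb_integrable s0 _) => //.
      exact: (resolvent_Brho ws gfs P1 M1 gb).
    - by apply: integrableZl => //; exact: iR.
    - by move=> w _; rewrite -EFinM lee_fin; exact: resolvent_P_le.
  rewrite integralZl//; last exact: iR.
  rewrite muleA -EFinM -expRD.
  by have -> : - (beta * t) + beta * (t - s) = - (beta * s) by ring.
Qed.

(** Positive and negative parts are treated separately, since the supermartingale argument is for
    [f >= 0]; the continuous factor [expR (beta * q)] removes the discount. *)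
Lemma resolvent_regulated beta f : omega < beta -> Brho rho f ->
  {ae mu, forall w, regulated (fun q => resolvent P beta f (lamb q w))}.
Proof.
move=> ob bf.
pose fp x := Num.max (f x) 0; pose fm x := Num.max (- f x) 0.
have bp : Brho rho fp by exact: Brho_maxr0.
have bm : Brho rho fm.
  apply: Brho_maxr0 => //; have := Brho_lin ws (-1) 0 bf bf.
  by congr (Brho _ _); apply/funext => x; ring.
have p0 x : 0 <= fp x by rewrite /fp le_max lexx orbT.
have m0 x : 0 <= fm x by rewrite /fm le_max lexx orbT.
have fE : f = (fun x => 1 * fp x + (-1) * fm x).
  by apply/funext => x; rewrite /fp /fm; case: (leP (f x) 0) => h1;
    case: (leP (- f x) 0) => h2; lra.
have h1 := supermartingale_regulated fF (resolvent_supermartingale ob bp p0).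
have h2 := supermartingale_regulated fF (resolvent_supermartingale ob bm m0).
apply: filterS2 h1 h2 => w r1 r2.
have ce : continuous (fun q : R => expR (beta * q)).
  move=> q; apply: (@continuous_comp _ _ _ (fun q : R => beta * q) expR).
    exact: mulrl_continuous.
  exact: continuous_expR.
have := regulatedM ce (regulatedB r1 r2).
congr (regulated _); apply/funext => q; rewrite [in RHS]fE (resolvent_lin ws gfs M1 gb ob)//.
rewrite mulrBr !mulrA -!expRD addrN expR0; ring.
Qed.

(** The limit [Y] is quantified inside, so the lemma does not presuppose that the path is regulated.
    The clamp keeps the functions bounded by 1, as dominated convergence requires. *)
Lemma lamb_limit_le g t : 0 <= t -> Brho rho g ->
  {ae mu, forall w (Y : R), g (lamb (dyadic_above t n) w) @[n --> \oo] --> Y -> Y <= g (lamb t w)}.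
Proof.
move=> t0 bg.
have q0 n : 0 <= dyadic_above t n by exact: dyadic_ge0 (dyadic_dyadic_above _ _).
have tq n : t <= dyadic_above t n by exact/ltW/dyadic_above_gt.
(* Rational thresholds [a] keep the union of exceptional sets countable. *)
suff h (a : rat) : {ae mu, forall w (Y : R), g (lamb (dyadic_above t n) w) @[n --> \oo] --> Y ->
    g (lamb t w) <= ratr a -> Y <= ratr a}.
  have := ae_forall_countable h; apply: filterS => w hw Y cY.
  rewrite leNgt; apply/negP => /rat_in_itvoo[a]; rewrite in_itv /= => /andP[ga aY].
  by have := hw a Y cY (ltW ga); rewrite leNgt aY.
pose c : R := ratr a.
pose phi (y : R) := Num.min (Num.max (y - c) 0) 1.
have lphi x y : `|phi x - phi y| <= `|x - y| by exact: clamp_lipschitz.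
have phi01 y : 0 <= phi y <= 1.
  by rewrite /phi ge_min lexx orbT andbT le_min ler01 andbT le_max lexx orbT.
have bphi : Brho rho (phi \o g) by exact: Brho_lipschitz.
pose A := [set w | g (lamb t w) <= c].
have FA : F t A.
  have := borel_lamb_Gmeas t0 (Brho_borel_measurable ws bg) (measurable_itv `]-oo, c]).
  by congr (F _ _); apply/seteqP; split => w /=; rewrite in_itv.
have mA : measurable A := F_measurable t0 FA.
pose u n w := (phi (g (lamb (dyadic_above t n) w)))%:E.
have mu_ n : measurable_fun A (u n).
  apply: measurable_funTS; apply/measurable_EFinP.
  exact: (borel_lamb_measurable (q0 n) (Brho_borel_measurable ws bphi)).
have u0 n w : (0 <= u n w)%E by rewrite lee_fin; have /andP[] := phi01 (g (lamb (dyadic_above t n) w)).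
have cvg0 : (\int[mu]_(w in A) u n w @[n --> \oo] --> 0)%E.
  have -> : (fun n => \int[mu]_(w in A) u n w)%E =
      (fun n => \int[mu]_(w in A) (P (dyadic_above t n - t) (phi \o g) (lamb t w))%:E)%E.
    apply/funext => n; have tqn : 0 <= t <= dyadic_above t n by rewrite t0 tq.
    by have [_ <-] := markov tqn bphi.
  have d0 n : 0 <= dyadic_above t n - t by rewrite subr_ge0.
  have -> : 0%E = (\int[mu]_(w in A) (phi (g (lamb t w)))%:E)%E.
    apply/esym/integral0_eq => w Aw; rewrite /phi.
    by rewrite (@max_r _ _ (g (lamb t w) - c)) ?subr_le0// min_l.
  have [||||| _ _ h] := @dominated_convergence _ _ _ mu A mA
    (fun n w => (P (dyadic_above t n - t) (phi \o g) (lamb t w))%:E)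
    (fun w => (phi (g (lamb t w)))%:E) (fun=> 1%E).
  - move=> n; apply: measurable_funTS; apply/measurable_EFinP.
    exact: (borel_lamb_measurable t0 (Brho_borel_measurable ws (P_Brho gfs (d0 n) bphi))).
  - apply: measurable_funTS; apply/measurable_EFinP.
    exact: (borel_lamb_measurable t0 (Brho_borel_measurable ws bphi)).
  - apply: aeW => w _; apply: cvg_EFin; first by apply: nearW.
    have := gfs.2.2.2.2.2.1 (phi \o g) bphi (lamb t w); apply: cvg_comp.
    move=> B [e /= e0 hB].
    have /cvgrPdist_lt /(_ e e0) := cvg_dyadic_above t0; apply: filterS => n hn.
    apply: hB; last by rewrite subr_gt0 dyadic_above_gt.
    by rewrite /= sub0r opprB.
  - exact: finite_measure_integrable_cst.
  - apply: aeW => w n _; rewrite abse_EFin lee_fin; apply: (P_bounded ws gfs P1) => //.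
    by move=> x /=; have /andP[? ?] := phi01 (g x); rewrite ger0_norm.
  exact: h.
(* The integrals over [A] tend to 0, so the lower limit of the clamped values vanishes almost
   everywhere on [A]; a limit [Y] above [c] would make it positive. *)
have := fatou mu mA mu_ (fun n w _ => u0 n w).
rewrite (cvg_limn_einf_sup cvg0).1 => int0.
have mL : measurable_fun A (fun w => limn_einf (u^~ w)) by exact: measurable_fun_limn_einf.
have L0 w : (0 <= limn_einf (u^~ w))%E.
  rewrite limn_einf_lim; apply: lime_ge; first exact: is_cvg_einfs.
  by apply: nearW => n; apply: le_ereal_inf_tmp => _ [m _ <-].
have : (\int[mu]_(w in A) `|limn_einf (u^~ w)| = 0)%E.
  under eq_integral do rewrite gee0_abs//.
  by apply/eqP; rewrite eq_le int0 integral_ge0.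
move=> /(ae_eq_integral_abs mu mA mL); apply: filterS => w hw Y cY gc.
have {hw} hw : limn_einf (u^~ w) = 0%E := hw gc.
have : u n w @[n --> \oo] --> (phi Y)%:E.
  apply: cvg_EFin; first by apply: nearW.
  apply/cvgrPdist_lt => e e0; move/cvgrPdist_lt : cY => /(_ e e0); apply: filterS => n.
  by rewrite /u /=; apply: le_lt_trans; exact: lphi.
move=> /cvg_limn_einf_sup[+ _]; rewrite hw => -[] /esym.
rewrite /phi => hphi; rewrite leNgt; apply/negP => cY'.
move: hphi; rewrite max_l ?subr_ge0 ?(ltW cY')//.
by rewrite -/c in cY' *; case: (leP (Y - c) 1) => h; lra.
Qed.

Lemma lamb_limit_eq g t : 0 <= t -> Brho rho g ->
  {ae mu, forall w (Y : R), g (lamb (dyadic_above t n) w) @[n --> \oo] --> Y -> Y = g (lamb t w)}.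
Proof.
move=> t0 bg.
have bN : Brho rho (fun x => - g x).
  have := Brho_lin ws (-1) 0 bg bg.
  by congr (Brho _ _); apply/funext => x; ring.
have h1 := lamb_limit_le t0 bg; have h2 := lamb_limit_le t0 bN.
apply: filterS2 h1 h2 => w h1 h2 Y cY; apply/eqP; rewrite eq_le h1//=.
by rewrite -lerN2; apply: h2; exact: cvgN.
Qed.

Lemma regulated_version (J : countType) (g : J -> E -> R) :
  (forall j, Brho rho (g j)) ->
  (forall j, {ae mu, forall w, regulated (fun q => g j (lamb q w))}) ->
  forall t, 0 <= t -> {ae mu, forall w j, g j (lamb t w) = rlim (fun q => g j (lamb q w)) t}.
Proof.
move=> bg rg t t0; apply: ae_forall_countable => j.
have := lamb_limit_eq t0 (bg j); apply: filterS2 (rg j) => w rw hw.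
by apply/esym/hw; exact: rlim_cvg_seq.
Qed.

End process.

(** * The weight along the process *)

Section weight_process.
Context (d : measure_display) (T : measurableType d) (R : realType) (mu : probability T R).
Context (E : ptopologicalType) (rho : E -> R).
Variables (P : R -> (E -> R) -> (E -> R)) (omega : R).
Hypothesis ws : weighted_space rho.
Hypothesis gfs : gen_feller_semigroup rho P.
Hypothesis P1 : forall t, 0 <= t -> P t (fun _ => 1) = (fun _ => 1).
Hypothesis gb : growth_bound rho P 1 omega.
Variables (F : R -> set (set T)) (lamb : R -> T -> E).
Hypothesis fF : filtration F.
Hypothesis adapted : forall t, 0 <= t -> forall A : set (borelE E), measurable A ->
  F t (lamb t @^-1` A).
Hypothesis markov : forall s t, 0 <= s <= t -> forall f, Brho rho f ->
  mu.-integrable setT (fun w => (f (lamb t w))%:E) /\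
  forall B, F s B -> (\int[mu]_(w in B) (f (lamb t w))%:E =
    \int[mu]_(w in B) (P (t - s) f (lamb s w))%:E)%E.
Hypothesis init : (\int[mu]_w (rho (lamb 0 w))%:E < +oo)%E.
Hypothesis bairerho : forall B : set R, measurable B -> @baire_sets R E (rho @^-1` B).
Implicit Types f g : E -> R.

Let rho_gt0 : forall x, 0 < rho x := ws.2.2.1.
Let M1 : 1 <= 1 :> R := lexx 1.

Lemma weight_lamb_measurable t : 0 <= t -> measurable_fun setT (fun w => rho (lamb t w)).
Proof. by move=> t0; exact: (borel_lamb_measurable fF adapted t0 (weight_borel_measurable ws)). Qed.

(* L h plays the role of P h rho, which is not given by P since rho need not be in B^rho. *)
Lemma weight_transition : exists L : R -> E -> R,
  (forall h, 0 <= h -> [/\ measurable_fun setT (L h : borelE E -> R),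
    forall x, 0 <= L h x & forall x, L h x <= expR (omega * h) * rho x]) /\
  (forall s t, 0 <= s <= t -> forall B, F s B ->
    (\int[mu]_(w in B) (rho (lamb t w))%:E = \int[mu]_(w in B) (L (t - s) (lamb s w))%:E)%E).
Proof.
have [f [cf f_le fS f_cvg]] := weight_approximation ws bairerho.
have bf k : Brho rho (f k) := Cb_Brho ws (cf k).
pose L h x := limn (fun k => P h (f k) x).
have ndP h x : 0 <= h -> nondecreasing_seq (fun k => P h (f k) x).
  by move=> h0; apply/nondecreasing_seqP => k; exact: (P_mono ws gfs).
have leP_ h k x : 0 <= h -> P h (f k) x <= expR (omega * h) * rho x.
  move=> h0; have := @P_growth R E rho P 1 omega ws M1 gb h (f k) 1 h0 (bf k) ler01.
  move=> H; have := H _ x; rewrite !mul1r mulr1; move=> H'; apply: le_trans (ler_norm _) (H' _).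
  by move=> y; have /andP[? ?] := f_le k y; rewrite mul1r ger0_norm.
have P_ge k h x : 0 <= h -> 0 <= P h (f k) x.
  by move=> h0; apply: (P_ge0 gfs) => // y; have /andP[] := f_le k y.
have cvgL h x : 0 <= h -> P h (f k) x @[k --> \oo] --> L h x.
  move=> h0; apply: nondecreasing_is_cvgn; first exact: ndP.
  by exists (expR (omega * h) * rho x) => _ [k _ <-]; exact: leP_.
exists L; split.
  move=> h h0; split.
  - apply: (@measurable_fun_cvg _ (borelE E) R setT (fun k => P h (f k)) (L h)).
      by move=> k; exact: (Brho_borel_measurable ws (P_Brho gfs h0 (bf k))).
    by move=> x _; exact: cvgL.
  - move=> x; apply: (limr_ge _); first exact: (cvgP _ (cvgL h x h0)).
    by apply: nearW => k; exact: P_ge.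
  - move=> x; apply: (limr_le _); first exact: (cvgP _ (cvgL h x h0)).
    by apply: nearW => k; exact: leP_.
move=> s t st B FB; have /andP[s0 st'] := st.
have t0 : 0 <= t := le_trans s0 st'.
have h0 : 0 <= t - s by rewrite subr_ge0.
have mB : measurable B := F_measurable fF s0 FB.
have c1 : (\int[mu]_(w in B) (f k (lamb t w))%:E @[k --> \oo] -->
    \int[mu]_(w in B) (rho (lamb t w))%:E)%E.
  have -> : (fun w => (rho (lamb t w))%:E) = (fun w => limn (fun k => (f k (lamb t w))%:E)).
    apply/funext => w; apply/esym/cvg_lim => //.
    by apply: cvg_EFin; [exact: nearW|exact: f_cvg].
  apply: cvg_monotone_convergence => //.
  - move=> k; apply: measurable_funTS; apply/measurable_EFinP.
    exact: (borel_lamb_measurable fF adapted t0 (Brho_borel_measurable ws (bf k))).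
  - by move=> k w _; rewrite lee_fin; have /andP[] := f_le k (lamb t w).
  - move=> w _; apply/nondecreasing_seqP => k; rewrite lee_fin; exact: fS.
have c2 : (\int[mu]_(w in B) (P (t - s) (f k) (lamb s w))%:E @[k --> \oo] -->
    \int[mu]_(w in B) (L (t - s) (lamb s w))%:E)%E.
  have -> : (fun w => (L (t - s) (lamb s w))%:E) =
      (fun w => limn (fun k => (P (t - s) (f k) (lamb s w))%:E)).
    apply/funext => w; apply/esym/cvg_lim => //.
    by apply: cvg_EFin; [exact: nearW|exact: cvgL].
  apply: cvg_monotone_convergence => //.
  - move=> k; apply: measurable_funTS; apply/measurable_EFinP.
    exact: (borel_lamb_measurable fF adapted s0 (Brho_borel_measurable ws (P_Brho gfs h0 (bf k)))).
  - by move=> k w _; rewrite lee_fin; exact: P_ge.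
  - by move=> w _ i j ij; rewrite lee_fin; exact: ndP.
have eq12 : (fun k => \int[mu]_(w in B) (f k (lamb t w))%:E)%E =
    (fun k => \int[mu]_(w in B) (P (t - s) (f k) (lamb s w))%:E)%E.
  by apply/funext => k; have [_ ->] := markov st (bf k).
rewrite eq12 in c1; exact: (cvg_unique _ c1 c2).
Qed.

Lemma weight_lamb_integrable t : 0 <= t -> mu.-integrable setT (fun w => (rho (lamb t w))%:E).
Proof.
move=> t0; have [L [hL intL]] := weight_transition.
apply/integrableP; split; first by apply/measurable_EFinP; exact: weight_lamb_measurable.
under eq_integral do rewrite gee0_abs ?lee_fin ?ltW//.
have FT : F 0 setT.
  by have [/(_ 0 (lexx _)) sF _ _] := fF; rewrite -setC0; apply: sigma_algebra_setC => //; case: sF.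
have [mL L0 Lle] := hL t t0.
rewrite (intL 0 t) ?lexx// subr0.
apply: (@le_lt_trans _ _ (\int[mu]_w ((expR (omega * t))%:E * (rho (lamb 0 w))%:E))%E).
  apply: ge0_le_integral => //.
  - by move=> w _; rewrite lee_fin.
  - apply/measurable_EFinP; exact: (borel_lamb_measurable fF adapted (lexx 0) mL).
  - apply: measurable_funeM; apply/measurable_EFinP; exact: weight_lamb_measurable.
  - by move=> w _; rewrite -EFinM lee_fin.
rewrite ge0_integralZl//.
- by rewrite lte_mul_pinfty ?lee_fin ?expR_ge0.
- by apply/measurable_EFinP; exact: weight_lamb_measurable.
- by move=> w _; rewrite lee_fin ltW.
Qed.

Definition weight_mart (t : R) (w : T) : R := expR (- (omega * t)) * rho (lamb t w).

Lemma weight_mart_integrable t : 0 <= t -> mu.-integrable setT (EFin \o weight_mart t).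
Proof.
move=> t0; rewrite /weight_mart /comp; under eq_fun do rewrite EFinM.
by apply: integrableZl => //; exact: weight_lamb_integrable.
Qed.

Lemma weight_mart_Gmeas t : 0 <= t -> Gmeas (F t) (weight_mart t).
Proof.
move=> t0; apply: (borel_lamb_Gmeas adapted (f := fun x => expR (- (omega * t)) * rho x) t0).
apply: measurable_funM; first exact: measurable_cst.
exact: (weight_borel_measurable ws).
Qed.

(** The conditional expectation is given explicitly by [L (t - s)] at the position [lamb s]; the
    bound on [L] therefore yields the inequality at every [w]. *)
Lemma weight_conditional s t : 0 <= s <= t -> exists Y : T -> R,
  [/\ Gmeas (F s) Y, mu.-integrable setT (EFin \o Y),
    forall B, F s B -> (\int[mu]_(w in B) (weight_mart t w)%:E = \int[mu]_(w in B) (Y w)%:E)%E &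
    forall w, Y w <= weight_mart s w].
Proof.
move=> st; have /andP[s0 st'] := st; have t0 : 0 <= t := le_trans s0 st'.
have [L [hL intL]] := weight_transition.
have h0 : 0 <= t - s by rewrite subr_ge0.
have [mL L0 Lle] := hL _ h0.
pose Y w := expR (- (omega * t)) * L (t - s) (lamb s w).
have mY : measurable_fun setT (fun x : borelE E => expR (- (omega * t)) * L (t - s) x).
  by apply: measurable_funM => //; exact: measurable_cst.
have Yle w : Y w <= weight_mart s w.
  rewrite /Y /weight_mart; apply: (@le_trans _ _ (expR (- (omega * t)) *
    (expR (omega * (t - s)) * rho (lamb s w)))).
    by apply: ler_wpM2l; [exact: expR_ge0|exact: Lle].
  rewrite mulrA -expRD.
  by have -> : - (omega * t) + omega * (t - s) = - (omega * s) by ring.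
have Y0 w : 0 <= Y w by rewrite mulr_ge0 ?expR_ge0.
have iY : mu.-integrable setT (EFin \o Y).
  apply: (le_integrable measurableT _ _ (weight_mart_integrable s0)).
    apply/measurable_EFinP; exact: (borel_lamb_measurable fF adapted s0 mY).
  move=> w _ /=; rewrite lee_fin ger0_norm//.
  by rewrite (le_trans (Yle w))// ler_norm.
exists Y; split => //; first exact: (borel_lamb_Gmeas adapted s0 mY).
move=> B FB; have mB : measurable B := F_measurable fF s0 FB.
rewrite /weight_mart /Y; under eq_integral do rewrite EFinM.
under [RHS]eq_integral do rewrite EFinM.
rewrite ge0_integralZl//; first last.
- by move=> w _; rewrite lee_fin ltW.
- by apply: measurable_funTS; apply/measurable_EFinP; exact: weight_lamb_measurable.
rewrite (intL s t st B FB) ge0_integralZl//.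
- apply: measurable_funTS; apply/measurable_EFinP.
  exact: (borel_lamb_measurable fF adapted s0 mL).
- by move=> w _; rewrite lee_fin.
Qed.

Lemma weight_supermartingale : nonneg_supermartingale mu F weight_mart.
Proof.
split.
- by move=> t w _; rewrite mulr_ge0 ?expR_ge0// ltW.
- exact: weight_mart_Gmeas.
- exact: weight_mart_integrable.
- move=> s t st A FA; have /andP[s0 st'] := st.
  have mA : measurable A := F_measurable fF s0 FA.
  have [Y [GY iY hY Yle]] := weight_conditional st; rewrite hY//.
  apply: le_integral => //.
  + exact: integrableS iY.
  + by apply: integrableS (weight_mart_integrable s0).
  + by move=> w _; rewrite lee_fin.
Qed.

Definition locally_in_sublevel (w : T) : Prop := forall t : R, exists2 r : R, 0 <= r &
  forall q : R, dyadic q -> q <= t -> rho (lamb q w) <= r.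

(** The discounted weight is bounded along the whole path; as [omega >= 0], removing the discount up
    to time [t] costs at most [expR (omega * t)]. *)
Lemma ae_locally_in_sublevel : {ae mu, forall w, locally_in_sublevel w}.
Proof.
have := supermartingale_bounded fF weight_supermartingale.
apply: filterS => w [C hC] t; have om0 := omega_ge0 ws P1 M1 gb.
exists (expR (omega * t) * `|C|); first by rewrite mulr_ge0 ?expR_ge0.
move=> q dq qt; have := hC q dq; rewrite /weight_mart expRN mulrC ler_pdivrMr ?expR_gt0//.
move=> /le_trans; apply; rewrite mulrC.
apply: (@le_trans _ _ (expR (omega * q) * `|C|)).
  by apply: ler_wpM2l; [exact: expR_ge0|exact: ler_norm].
by apply: ler_wpM2r => //; rewrite ler_expR ler_wpM2l.
Qed.

Lemma locally_in_sublevel_near (w : T) (G : set_system R) (t : R) :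
  locally_in_sublevel w -> (G = dright t \/ G = dleft t) ->
  exists2 r, 0 <= r & G [set q | rho (lamb q w) <= r].
Proof.
move=> /(_ (t + 1))[r r0 hr] [->|->]; exists r => //.
  by apply/drightP; exists 1 => // q dq /andP[_ /ltW]; exact: hr.
by apply/dleftP; exists 1 => // q dq /andP[_ qt]; apply: hr => //; lra.
Qed.

(** The resolvents at integer parameters act as coordinates on the compact sublevel set: their
    limits select a point [x], and they determine [f] there. *)
Lemma Brho_lamb_limit f (w : T) (G : set_system R) (r : R) : ProperFilter G -> Brho rho f ->
  0 <= r -> G [set q | rho (lamb q w) <= r] ->
  (forall beta : int, omega < beta%:~R ->
    exists l : R, resolvent P beta%:~R f (lamb q w) @[q --> G] --> l) ->
  exists l : R, f (lamb q w) @[q --> G] --> l.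
Proof.
move=> PG bf r0 Gr hl.
pose J := {beta : int | omega < beta%:~R}.
pose H (j : J) := resolvent P (sval j)%:~R f.
have cK : compact [set x | rho x <= r] by exact: ws.2.2.2.
have cH (j : J) : within_cont [set x | rho x <= r] (H j).
  exact: (resolvent_within_cont ws gfs M1 gb (valP j)).
have [j|x Kx Hx] := @cluster_limit R E J (fun=> R : topologicalType) G (lamb^~ w)
  [set x | rho x <= r] H PG cK Gr (fun=> @Rhausdorff R) cH.
  exact: (hl _ (valP j)).
exists (f x); apply: (@cvg_cluster_separated R E R J (fun=> R : topologicalType) G (lamb^~ w)
  [set x | rho x <= r] x H f) => //.
- exact: (Brho_within_cont ws).
- move=> z Kz hz; apply: (resolvent_separates ws gfs P1 M1 gb bf) => beta hb.
  exact: (hz (exist _ beta hb)).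
Qed.

Lemma Brho_regulated f : Brho rho f ->
  {ae mu, forall w, regulated (fun q => f (lamb q w))}.
Proof.
move=> bf.
have hR : {ae mu, forall w (beta : int), omega < beta%:~R ->
    regulated (fun q => resolvent P beta%:~R f (lamb q w))}.
  apply: ae_forall_countable => beta.
  have [ob|nob] := pselect (omega < beta%:~R); last by apply: aeW.
  have := resolvent_regulated ws gfs P1 M1 gb fF adapted markov ob bf.
  by apply: filterS => w hw _.
apply: filterS2 ae_locally_in_sublevel hR => w hw hR.
split=> t t0.
- have pf := dright_proper t0.
  have [r r0 hr] := locally_in_sublevel_near hw (or_introl (erefl (dright t))).
  apply: (Brho_lamb_limit pf bf r0 hr) => beta /hR[+ _]; exact.
- have pf := dleft_proper t0.
  have [r r0 hr] := locally_in_sublevel_near hw (or_intror (erefl (dleft t))).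
  apply: (Brho_lamb_limit pf bf r0 hr) => beta /hR[_ +]; exact.
Qed.

(** The approximants [f k], for which right limits are already identified, show that the right limit
    is at least the value at [t]; Fatou's lemma and the supermartingale property give the reverse
    inequality in mean. A nonnegative difference of nonpositive mean vanishes almost everywhere. *)
Lemma weight_version t : 0 <= t ->
  {ae mu, forall w, weight_mart t w = rlim (fun q => weight_mart q w) t}.
Proof.
move=> t0.
have [f [cf f_le fS f_cvg]] := weight_approximation ws bairerho.
have bf k : Brho rho (f k) := Cb_Brho ws (cf k).
have hf := regulated_version ws gfs P1 fF adapted markov bf (fun k => Brho_regulated (bf k)) t0.
have hrf : {ae mu, forall w (k : nat), regulated (fun q => f k (lamb q w))}.
  by apply: ae_forall_countable => k; exact: Brho_regulated.
have hr := supermartingale_regulated fF weight_supermartingale.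
have q0 n : 0 <= dyadic_above t n by exact: dyadic_ge0 (dyadic_dyadic_above _ _).
have ge : {ae mu, forall w, weight_mart t w <= rlim (fun q => weight_mart q w) t}.
  apply: filterS3 hf hrf hr => w hf hrf hr.
  have cr := rlim_cvg_seq hr t0.
  have c1 : f k (lamb t w) @[k --> \oo] --> rho (lamb t w) by exact: f_cvg.
  have hk k : expR (- (omega * t)) * f k (lamb t w) <= rlim (fun q => weight_mart q w) t.
    have ce : expR (- (omega * dyadic_above t n)) @[n --> \oo] --> expR (- (omega * t)).
      apply: continuous_cvg; first exact: continuous_expR.
      apply: cvgN.
      by apply: cvgM; [exact: cvg_cst|exact: cvg_dyadic_above].
    have c2 : expR (- (omega * dyadic_above t n)) * f k (lamb (dyadic_above t n) w)
        @[n --> \oo] --> expR (- (omega * t)) * f k (lamb t w).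
      by apply: cvgM => //; rewrite hf; exact: rlim_cvg_seq.
    apply: (ler_cvg_to c2 cr); apply: nearW => n; rewrite /weight_mart.
    by apply: ler_wpM2l; [exact: expR_ge0|have /andP[] := f_le k (lamb (dyadic_above t n) w)].
  have c3 : expR (- (omega * t)) * f k (lamb t w) @[k --> \oo] --> weight_mart t w.
    by apply: cvgM => //; exact: cvg_cst.
  apply: (ler_cvg_to c3 (cvg_cst _)); exact: nearW.
have [X0 _ iX sX] := weight_supermartingale.
pose u n w := (weight_mart (dyadic_above t n) w)%:E.
have mu_ n : measurable_fun setT (u n) by exact: measurable_int (iX _ (q0 n)).
have u0 n w : (0 <= u n w)%E by rewrite lee_fin X0.
(* A measurable stand-in for the right limit, equal to it on regulated paths. *)
pose La w := limn_einf (u^~ w).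
have mL : measurable_fun setT La by exact: measurable_fun_limn_einf.
have La0 w : (0 <= La w)%E.
  rewrite /La limn_einf_lim; apply: lime_ge; first exact: is_cvg_einfs.
  by apply: nearW => n; apply: le_ereal_inf_tmp => _ [m _ <-].
have FT : F t setT.
  by have [/(_ t t0) sF _ _] := fF; rewrite -setC0; apply: sigma_algebra_setC => //; case: sF.
have intL : (\int[mu]_w La w <= \int[mu]_w (weight_mart t w)%:E)%E.
  apply: (le_trans (fatou mu measurableT mu_ (fun n w _ => u0 n w))).
  rewrite limn_einf_lim; apply: lime_le; first exact: is_cvg_einfs.
  apply: nearW => n; apply: ereal_inf_le.
  exists (\int[mu]_w u n w)%E; first by exists n => /=.
  by apply: sX => //; rewrite t0 ltW// dyadic_above_gt.
have Lrlim : {ae mu, forall w, La w = (rlim (fun q => weight_mart q w) t)%:E}.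
  apply: filterS hr => w hr; apply: (cvg_limn_einf_sup _).1.
  by apply: cvg_EFin; [exact: nearW|exact: rlim_cvg_seq].
have it := iX t t0.
have iL : mu.-integrable setT La.
  apply/integrableP; split => //; under eq_integral do rewrite gee0_abs//.
  by apply: le_lt_trans intL _; exact: integrable_lty.
have iD : mu.-integrable setT (fun w => (La w - (weight_mart t w)%:E)%E) by exact: integrableB.
have mD := measurable_int _ iD.
have D0 : {ae mu, forall w, [set: T] w -> (`|La w - (weight_mart t w)%:E| = La w - (weight_mart t w)%:E)%E}.
  apply: filterS2 ge Lrlim => w h1 -> _.
  by rewrite gee0_abs// -EFinB lee_fin subr_ge0.
have eqI : (\int[mu]_w `|La w - (weight_mart t w)%:E| =
    \int[mu]_w (La w - (weight_mart t w)%:E))%E.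
  by apply: ae_eq_integral => //; exact: measurableT_comp.
have : (\int[mu]_w `|La w - (weight_mart t w)%:E| = 0)%E.
  apply/eqP; rewrite eq_le; apply/andP; split; last exact: integral_ge0.
  by rewrite eqI integralB// sube_le0.
move=> /(ae_eq_integral_abs mu measurableT mD) h.
apply: filterS2 Lrlim h => w -> /(_ I) /= /eqP.
by rewrite -EFinB eqe subr_eq0 => /eqP ->.
Qed.

(** Here the family [f] gives the coordinates and the map to be controlled is the identity of [E].
    The limits [f n x] are recorded because they later identify [x] with the position of the
    process. *)
Lemma separated_path_regulated (f : nat -> E -> R) (w : T) (G : set_system R) (r : R) :
  ProperFilter G -> (forall n, Brho rho (f n)) ->
  (forall x y : E, x <> y -> exists n, f n x <> f n y) ->
  0 <= r -> G [set q | rho (lamb q w) <= r] ->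
  (forall n, exists l : R, f n (lamb q w) @[q --> G] --> l) ->
  exists x : E, lamb q w @[q --> G] --> x /\ forall n, f n (lamb q w) @[q --> G] --> f n x.
Proof.
move=> PG bf sep r0 Gr hl.
have cK : compact [set x | rho x <= r] by exact: ws.2.2.2.
have cf n : within_cont [set x | rho x <= r] (f n) by exact: (Brho_within_cont ws).
have [x Kx Hx] := @cluster_limit R E nat (fun=> R : topologicalType) G (lamb^~ w)
  [set x | rho x <= r] f PG cK Gr (fun=> @Rhausdorff R) cf hl.
exists x; split => //.
apply: (@cvg_cluster_separated R E E nat (fun=> R : topologicalType) G (lamb^~ w)
  [set x | rho x <= r] x f id) => //.
- by apply: continuous_within_cont => z; exact: cvg_id.
- move=> z Kz hz; apply: contrapT => /sep[n]; exact.
Qed.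

Lemma path_version (f : nat -> E -> R) : (forall n, Brho rho (f n)) ->
  (forall x y : E, x <> y -> exists n, f n x <> f n y) ->
  forall t, 0 <= t -> {ae mu, forall w, lamb t w = rlim (lamb^~ w) t}.
Proof.
move=> bf sep t t0.
have hv := regulated_version ws gfs P1 fF adapted markov bf (fun k => Brho_regulated (bf k)) t0.
have hr : {ae mu, forall w (k : nat), regulated (fun q => f k (lamb q w))}.
  by apply: ae_forall_countable => k; exact: Brho_regulated.
apply: filterS3 ae_locally_in_sublevel hr hv => w hw hr hv.
have hright s : 0 <= s -> exists x : E, lamb q w @[q --> dright s] --> x /\
    forall n, f n (lamb q w) @[q --> dright s] --> f n x.
  move=> s0; have pf := dright_proper s0.
  have [r r0 Gr] := locally_in_sublevel_near hw (or_introl (erefl (dright s))).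
  by apply: (separated_path_regulated _ bf sep r0 Gr) => n; exact: (hr n).1.
have reg : regulated (lamb^~ w).
  split=> s s0; first by have [x [hx _]] := hright s s0; exists x.
  have pf := dleft_proper s0.
  have [r r0 Gr] := locally_in_sublevel_near hw (or_intror (erefl (dleft s))).
  have [|x [hx _]] := separated_path_regulated pf bf sep r0 Gr; last by exists x.
  by move=> n; exact: (hr n).2.
have [x [hx hfx]] := hright t t0; have pf := dright_proper t0.
have ex : rlim (lamb^~ w) t = x.
  by apply: (cvg_unique ws.2.1 (rlim_cvg reg t0) hx).
(* Both points have the same [f n]: one by passing to the limit along the path, the other by the
   version property of [f n]. *)
apply: contrapT => /sep[n]; apply; rewrite ex hv.
exact: (cvg_unique (@Rhausdorff R) (rlim_cvg (hr n) t0) (hfx n)).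
Qed.

End weight_process.

(** * The canonical process *)

Lemma ae_eq_integral_EFin (d : measure_display) (T : measurableType d) (R : realType)
    (mu : {measure set T -> \bar R}) (B : set T) (Y Z : T -> R) :
  measurable B -> measurable_fun setT Y -> measurable_fun setT Z ->
  {ae mu, forall w, Y w = Z w} ->
  (\int[mu]_(w in B) (Y w)%:E = \int[mu]_(w in B) (Z w)%:E)%E.
Proof.
move=> mB mY mZ YZ; apply: ae_eq_integral => //.
- by apply: measurable_funTS; exact/measurable_EFinP.
- by apply: measurable_funTS; exact/measurable_EFinP.
- by apply: filterS YZ => w -> _.
Qed.

Lemma integral_law (d d' : measure_display) (T : measurableType d) (S : measurableType d')
    (R : realType) (mu : {measure set T -> \bar R}) (nu : {measure set S -> \bar R})
    (phi : T -> S) (f : S -> R) : measurable_fun setT phi -> measurable_fun setT f ->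
  (forall x, 0 <= f x) -> (forall A, measurable A -> mu (phi @^-1` A) = nu A) ->
  (\int[mu]_w (f (phi w))%:E = \int[nu]_x (f x)%:E)%E.
Proof.
move=> mphi mf f0 law.
have mf' : measurable_fun setT (EFin \o f) by exact/measurable_EFinP.
have := @ge0_integral_pushforward _ _ _ _ R _ mphi mu setT _ measurableT mf'.
rewrite preimage_setT => <-; last by move=> x _; rewrite lee_fin.
by apply: eq_measure_integral => A mA _; exact: law.
Qed.

Section completed.
Context (R : realType) (E : ptopologicalType) (Pnu : probability (@Omega R E) R).

Lemma PbarE (A : set (@Omega R E)) : measurable A -> Pbar (Pnu := Pnu) A = Pnu A.
Proof. by move=> mA; rewrite /Pbar /completed_measure_extension /= measurable_mu_extE. Qed.

Lemma Pbar_setT : Pbar (Pnu := Pnu) setT = 1%E.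
Proof. by rewrite PbarE// probability_setT. Qed.

HB.instance Definition _ := Measure.on (@Pbar R E Pnu).
HB.instance Definition _ := Measure_isProbability.Build _ _ _ (@Pbar R E Pnu) Pbar_setT.

Lemma ae_Pnull (Q : OmegaBar Pnu -> Prop) : {ae (@Pbar R E Pnu), forall w, Q w} ->
  exists N, Pnull N /\ forall w, ~ N w -> Q w.
Proof.
move=> [N [mN N0 hN]]; exists N; split => // w nN; apply: contrapT => nQ; apply: nN.
exact: hN.
Qed.

Lemma Pnull_ae (Q : OmegaBar Pnu -> Prop) N : Pnull N -> (forall w, ~ N w -> Q w) -> {ae (@Pbar R E Pnu), forall w, Q w}.
Proof.
move=> [mN N0] h; exists N; split => // w /= nQ; apply: contrapT => nN; apply: nQ; exact: h.
Qed.
End completed.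

Theorem mainTheorem6 (R : realType) (E : ptopologicalType) (rho : E -> R)
    (P : R -> (E -> R) -> (E -> R)) (M omega : R)
    (nu : probability (borelE E) R)
    (Pnu : probability (@Omega R E) R)
    (F : R -> set (set (OmegaBar Pnu))) :
  weighted_space rho ->
  gen_feller_semigroup rho P ->
  (forall t, 0 <= t -> P t (fun _ => 1) = (fun _ => 1)) ->
  1 <= M ->
  growth_bound rho P M omega ->
  radon_prob_in_Mrho rho nu ->
  (* P_nu o lambda_0^{-1} = nu *)
  (forall A : set (borelE E), measurable A ->
     Pnu (@lam R E 0 @^-1` A) = nu A) ->
  complete_rc_filtration F ->
  (* lambda is (F_t)-adapted *)
  (forall t, 0 <= t -> forall A : set (borelE E), measurable A ->
     F t (@lam R E t @^-1` A)) ->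
  (* Markov property: E[f(lambda_t) | F_s] = P(t-s) f (lambda_s) a.s. *)
  (forall s t, 0 <= s <= t -> forall f, Brho rho f ->
     exists Y, cond_exp_version (F s) (fun w => f (lam t w)) Y /\
       exists N, Pnull N /\ forall w, ~ N w -> Y w = P (t - s) f (lam s w)) ->
  (* (i) *)
  (forall f : nat -> E -> R, (forall n, Brho rho (f n)) ->
     exists Z : int -> nat -> R -> OmegaBar Pnu -> R,
       (forall (beta : int) n, omega < beta%:~R -> forall w, cadlag (fun t => Z beta n t w)) /\
       (forall t, 0 <= t -> exists N, F 0 N /\ Pnull N /\
          forall w, ~ N w -> forall (beta : int) n, omega < beta%:~R ->
            beta%:~R * resolvent P beta%:~R (f n) (lam t w) = Z beta n t w)) /\
  (* (ii) *)
  ((forall B : set R, measurable B -> @baire_sets R E (rho @^-1` B)) ->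
   growth_bound rho P 1 omega ->
   supermartingale F (fun t w => expR (- (omega * t)) * rho (lam t w)) /\
   ((exists N : set (borelE E), measurable N /\ nu N = 0%E /\
       forall x, ~ N x -> {within [set t : R | 0 <= t], continuous (fun t => P_rho rho P t x)}) ->
    (exists X : R -> OmegaBar Pnu -> R,
       (forall w, cadlag (fun t => X t w)) /\
       (forall t, 0 <= t -> exists N, Pnull N /\
          forall w, ~ N w -> expR (- (omega * t)) * rho (lam t w) = X t w)) /\
    (forall f : nat -> E -> R, (forall n, Brho rho (f n)) ->
       exists Y : nat -> R -> OmegaBar Pnu -> R,
         (forall n w, cadlag (fun t => Y n t w)) /\
         (forall t, 0 <= t -> exists N, F 0 N /\ Pnull N /\
            forall w, ~ N w -> forall n, f n (lam t w) = Y n t w)) /\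
    (* (iii) *)
    (forall f : nat -> E -> R,
       (forall n, Brho rho (f n) /\ seq_continuous (f n)) ->
       (forall x y : E, x <> y -> exists n, f n x <> f n y) ->
       exists Y : R -> OmegaBar Pnu -> E,
         (forall w, cadlag (fun t => Y t w)) /\
         (forall t, 0 <= t -> exists N, Pnull N /\
            forall w, ~ N w -> lam t w = Y t w)))).
Proof.
move=> ws gfs P1 M1 gb [_ nurho] law0 [sF [Fm [Fmono [_ Fcomplete]]]] adapted markov0.
pose mu : probability (OmegaBar Pnu) R := @Pbar R E Pnu.
pose lamb : R -> OmegaBar Pnu -> E := fun t w => lam t w.
have fF : filtration F by split.
have mlamb t : 0 <= t -> measurable_fun setT (lamb t : OmegaBar Pnu -> borelE E).
  by move=> t0; exact: (lamb_measurable fF adapted t0).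
(* The conditional expectation is traded for equality of integrals over events of [F s], the form
   used on an abstract probability space above. *)
have markov s t : 0 <= s <= t -> forall f, Brho rho f ->
    mu.-integrable setT (fun w => (f (lamb t w))%:E) /\
    forall B, F s B -> (\int[mu]_(w in B) (f (lamb t w))%:E =
      \int[mu]_(w in B) (P (t - s) f (lamb s w))%:E)%E.
  move=> st f bf; have /andP[s0 st'] := st.
  have [Y [[iX [_ [iY hY]]] [N [nN hN]]]] := markov0 s t st f bf.
  split; first exact: iX.
  move=> B FB; have mB : measurable B.
    exact: (Fm s s0 B FB).
  rewrite [LHS](hY B FB).
  apply: (@ae_eq_integral_EFin _ _ _ mu B Y (fun w => P (t - s) f (lamb s w)) mB).
  - by apply/measurable_EFinP; exact: measurable_int iY.
  - apply: (borel_lamb_measurable fF adapted s0 (f := P (t - s) f)).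
    by apply: (Brho_borel_measurable ws); apply: (P_Brho gfs) => //; rewrite subr_ge0.
  - exact: (Pnull_ae nN hN).
have init : (\int[mu]_w (rho (lamb 0 w))%:E < +oo)%E.
  (* The completion agrees with [Pnu] on cylinder sets, which transfers the initial law. *)
  have eq0 (A : set (borelE E)) : measurable A -> mu (lamb 0 @^-1` A) = nu A.
    move=> mA; rewrite -(law0 A mA); apply: PbarE; apply: sub_sigma_algebra.
    by exists (insubd (Rplus0 R) 0), A; split; [exact: mA|].
  rewrite (@integral_law _ _ _ _ R mu nu (lamb 0) rho (mlamb 0 (lexx 0))
    (weight_borel_measurable ws) (fun x => ltW (ws.2.2.1 x)) eq0).
  exact: nurho.
have null Q : {ae mu, forall w, Q w} -> exists N, F 0 N /\ Pnull N /\ forall w, ~ N w -> Q w.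
  by move=> /ae_Pnull[N [nN hN]]; exists N; split => //; exact: Fcomplete.
split.
  move=> f bf.
  (* The value 0 at parameters not above [omega] makes this a countable family lying entirely in
     B^rho, handled with one null set per time. *)
  pose g (j : int * nat) : E -> R := if omega < j.1%:~R then
    (fun x => j.1%:~R * resolvent P j.1%:~R (f j.2) x) else (fun=> 0).
  have bg j : Brho rho (g j).
    rewrite /g; case: ifPn => [oj|_]; last by apply: (Cb_Brho ws); exact: Cb_cst.
    have bR := resolvent_Brho ws gfs P1 M1 gb oj (bf j.2).
    have := Brho_lin ws j.1%:~R 0 bR bR.
    by congr (Brho _ _); apply/funext => x; ring.
  have rg j : {ae mu, forall w, regulated (fun q => g j (lamb q w))}.
    rewrite /g; case: ifPn => [oj|_].
      have := resolvent_regulated ws gfs P1 M1 gb fF adapted markov oj (bf j.2).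
      apply: filterS => w hw; apply: regulatedM => //; exact: cst_continuous.
    by apply: aeW => w; split => t t0; exists 0; exact: cvg_cst.
  exists (fun beta n t w => rlim (fun q => g (beta, n) (lamb q w)) t); split.
    by move=> beta n _ w; apply: rlim_cadlag; exact: real_regular.
  move=> t t0; apply: null.
  have := regulated_version ws gfs P1 fF adapted markov bg rg t0.
  by apply: filterS => w hw beta n ob; rewrite -hw /g ob.
move=> baire gb1; split.
  split.
    move=> t t0; split.
      exact: (weight_mart_Gmeas omega ws adapted t0).
    exact: (weight_mart_integrable ws gfs gb1 fF adapted markov init baire t0).
  move=> s t st; have /andP[s0 st'] := st.
  have [Y [GY iY hY Yle]] := weight_conditional ws gfs gb1 fF adapted markov init baire st.
  exists Y; split.
    split; last by split.
    exact: (weight_mart_integrable ws gfs gb1 fF adapted markov init baire (le_trans s0 st')).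
  exists set0; split; last by move=> w _; exact: Yle.
  by split; [exact: measurable0|exact: (measure0 mu)].
move=> _; split.
  exists (fun t w => rlim (fun q => weight_mart rho omega lamb q w) t); split.
    by move=> w; apply: rlim_cadlag; exact: real_regular.
  move=> t t0; apply: ae_Pnull.
  exact: (weight_version ws gfs P1 gb1 fF adapted markov init baire t0).
have reg f : Brho rho f -> {ae mu, forall w, regulated (fun q => f (lamb q w))}.
  exact: (Brho_regulated ws gfs P1 gb1 fF adapted markov init baire).
split.
  move=> f bf; exists (fun n t w => rlim (fun q => f n (lamb q w)) t); split.
    by move=> n w; apply: rlim_cadlag; exact: real_regular.
  move=> t t0; apply: null.
  exact: (regulated_version ws gfs P1 fF adapted markov bf (fun n => reg _ (bf n)) t0).
(* For paths with values in [E], the regularity required by the càdlàg lemma comes from complete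
   regularity. *)
move=> f bf sep; exists (fun t w => rlim (lamb^~ w) t); split.
  by move=> w; apply: rlim_cadlag; exact: (@completely_regular_regular R _ ws.1).
move=> t t0; apply: ae_Pnull.
exact: (path_version ws gfs P1 gb1 fF adapted markov init baire (fun n => (bf n).1) sep t0).
Qed.
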